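(* Let $k$ be an algebraically closed field of characteristic $2$ and let $\langle f,g\rangle$ be a pencil of quadratic forms on $\mathbb{P}^{2M+1}_k$ such that $X:=V(f,g)\subset\mathbb{P}^{2M+1}_k$ is smooth and the Pfaffian of $\langle f,g\rangle$ has distinct roots. Let $\varphi:\mathbb{P}^{2M+1}_k\setminus X\to\mathbb{P}^1_k$ be the morphism defined by $\langle f,g\rangle$, and let $Z$ be the singular locus of $\varphi$. If $M\geq 2$, then there is an exact sequence of groups $$1\longrightarrow(\mathbb{Z}/2\mathbb{Z})^{M+1}\longrightarrow\pi_0(\mathrm{Aut}_X)\xrightarrow{\ \varphi_*\ }\mathrm{Aut}(\mathbb{P}^1_k;\varphi(Z)),$$ where $\mathrm{Aut}(\mathbb{P}^1_k;\varphi(Z))$ is the subgroup of $\mathrm{PGL}_2(k)$ whose action on $\mathbb{P}^1_k$ sends $\varphi(Z)$ to itself (but possibly permutes the points).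
   Context: $\mathrm{Aut}_X$ is the automorphism group scheme of $X$; for $M\ge 2$ it is finite and is a closed subgroup scheme of $\mathrm{PGL}_{2M+2}$. $\pi_0(\mathrm{Aut}_X)=\mathrm{Aut}_X/\mathrm{Aut}_X^0$ is identified with $\mathrm{Aut}_X(k)$. Pfaffian: for a quadratic form $q$ in $2M+2$ variables in characteristic $2$, let $A_q(x,y)=q(x+y)-q(x)-q(y)$; its determinant is a square and $\mathrm{Pf}(q):=\sqrt{\det(A_q)}$ (well defined up to a nonzero scalar). The Pfaffian of $\langle f,g\rangle$ is $\mathrm{Pf}_{\langle f,g\rangle}(t):=\mathrm{Pf}(f-tg)$. ''The Pfaffian has distinct roots'' means that the binary form $\mathrm{Pf}(sf-tg)$ of degree $M+1$ has $M+1$ pairwise distinct zeros in $\mathbb{P}^1(k)$ (a root at infinity is allowed). The morphism $\varphi$ is $[f:g]$, and $Z\subset\mathbb{P}^{2M+1}_k\setminus X$ is the closed subscheme cut out by the $2M$-th Fitting ideal of $\Omega^1_\varphi$; its support is the set of points where $\varphi$ is not smooth. The homomorphism $\varphi_*:\mathrm{Aut}_X\to\mathrm{PGL}_2$: every $\sigma\in\mathrm{Aut}_X(T)\subset\mathrm{PGL}_{2M+2}(T)$ preserves the pencil $\langle f_T,g_T\rangle$, and $\varphi_*\sigma$ is the induced automorphism of $\mathbb{P}^1_T$ satisfying $\varphi_T\circ\sigma=(\varphi_*\sigma)\circ\varphi_T$ on $\mathbb{P}^{2M+1}_T\setminus X_T$. For $M\geq2$ it is trivial on $\mathrm{Aut}^0_X$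 and hence factors through $\pi_0(\mathrm{Aut}_X)$; the factorization is again denoted $\varphi_*$. *)

(* Defs.v *)
From HB Require Import structures.
From mathcomp Require Import all_boot all_order all_fingroup all_algebra.
From mathcomp Require Import boolp.
From mathcomp Require Import mpoly generic_quotient.

Set Implicit Arguments.
Unset Strict Implicit.
Unset Printing Implicit Defensive.

Import GRing.Theory.
Local Open Scope ring_scope.
Local Open Scope quotient_scope.

Record GL (k : fieldType) (n : nat) :=
  MkGL { GLmx :> 'M[k]_n; GLmx_unit : GLmx \in unitmx }.

HB.instance Definition _ (k : fieldType) (n : nat) :=
  [isSub for @GLmx k n].
HB.instance Definition _ (k : fieldType) (n : nat) :=
  [Choice of GL k n by <:].

Section GLGroup.
Variables (k : fieldType) (n : nat).
Implicit Types A B C : GL k n.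

Lemma GL_mul_unit A B : (A : 'M[k]_n) *m B \in unitmx.
Proof. by rewrite unitmx_mul !GLmx_unit. Qed.
Lemma GL_inv_unit A : invmx A \in unitmx.
Proof. by rewrite unitmx_inv GLmx_unit. Qed.

Definition GL1 : GL k n := MkGL (unitmx1 k n).
Definition GLmul A B : GL k n := MkGL (GL_mul_unit A B).
Definition GLinv A : GL k n := MkGL (GL_inv_unit A).

Lemma GLmulA : associative GLmul.
Proof. by move=> A B C; apply: val_inj; rewrite /= mulmxA. Qed.
Lemma GLmul1 : left_id GL1 GLmul.
Proof. by move=> A; apply: val_inj; rewrite /= mul1mx. Qed.
Lemma GLmulr1 : right_id GL1 GLmul.
Proof. by move=> A; apply: val_inj; rewrite /= mulmx1. Qed.
Lemma GLmulV : left_inverse GL1 GLinv GLmul.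
Proof. by move=> A; apply: val_inj; rewrite /= mulVmx ?GLmx_unit. Qed.
Lemma GLmulrV : right_inverse GL1 GLinv GLmul.
Proof. by move=> A; apply: val_inj; rewrite /= mulmxV ?GLmx_unit. Qed.
End GLGroup.

HB.instance Definition _ (k : fieldType) (n : nat) :=
  isGroup.Build (GL k n) (@GLmulA k n) (@GLmul1 k n) (@GLmulr1 k n)
    (@GLmulV k n) (@GLmulrV k n).

Section PGLDef.
Variables (k : fieldType) (n : nat).
Implicit Types A B C : GL k n.

Definition GL_scal A B : bool := is_scalar_mx ((A : 'M[k]_n) *m invmx B).

Lemma GL_scalP A B :
  reflect (exists2 c : k, c != 0 & (A : 'M[k]_n) = c *: (B : 'M[k]_n))
          (GL_scal A B).
Proof.
rewrite /GL_scal; apply: (iffP is_scalar_mxP) => [[c Ec]|[c _ Ec]]; last first.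
  by exists c; rewrite Ec -scalemxAl mulmxV ?GLmx_unit // scalemx1.
have EA : (A : 'M[k]_n) = c *: (B : 'M[k]_n).
  by rewrite -[LHS](mulmxKV (GLmx_unit B)) Ec mul_scalar_mx.
have [c0|c_neq0] := eqVneq c 0; last by exists c.
exists 1; first exact: oner_neq0.
rewrite scale1r.
have A0 : (A : 'M[k]_n) = 0 by rewrite EA c0 scale0r.
have I0 : 1%:M = 0 :> 'M[k]_n by rewrite -(mulVmx (GLmx_unit A)) A0 mulmx0.
by rewrite -[LHS]mulmx1 -[RHS]mulmx1 I0 !mulmx0.
Qed.

Lemma GL_scal_refl : reflexive GL_scal.
Proof.
by move=> A; apply/GL_scalP; exists 1; rewrite ?oner_neq0 ?scale1r.
Qed.
Lemma GL_scal_sym : ssrbool.symmetric GL_scal.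
Proof.
have imp A B : GL_scal A B -> GL_scal B A.
  move=> /GL_scalP [c c0 E]; apply/GL_scalP; exists c^-1; first by rewrite invr_eq0.
  by rewrite E scalerA mulVf ?scale1r.
by move=> A B; apply/idP/idP; apply: imp.
Qed.
Lemma GL_scal_trans : transitive GL_scal.
Proof.
move=> B A C /GL_scalP [c c0 EA] /GL_scalP [d d0 EB].
by apply/GL_scalP; exists (c * d); rewrite ?mulf_neq0 // EA EB scalerA.
Qed.

Canonical GL_scal_equiv :=
  EquivRel GL_scal GL_scal_refl GL_scal_sym GL_scal_trans.

Definition PGL := {eq_quot GL_scal}.
HB.instance Definition _ := Choice.on PGL.
HB.instance Definition _ := EqQuotient.on PGL.

Lemma PGL_eqP A B : reflect (\pi_PGL A = \pi_PGL B) (GL_scal A B).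
Proof. by rewrite -(eqquotE PGL); apply: eqP. Qed.

Lemma PGL_reprP A :
  exists2 c : k, c != 0 & (repr (\pi_PGL A) : 'M[k]_n) = c *: (A : 'M[k]_n).
Proof. by apply/GL_scalP/PGL_eqP; rewrite reprK. Qed.

Definition PGL1 : PGL := \pi_PGL 1%g.
Definition PGLmul (s t : PGL) : PGL := \pi_PGL (repr s * repr t)%g.
Definition PGLinv (s : PGL) : PGL := \pi_PGL (repr s)^-1%g.

Lemma PGLmul_pi A B : PGLmul (\pi_PGL A) (\pi_PGL B) = \pi_PGL (A * B)%g.
Proof.
apply/PGL_eqP/GL_scalP.
have [c c0 /= Ec] := PGL_reprP A; have [d d0 /= Ed] := PGL_reprP B.
exists (c * d); first by rewrite mulf_neq0.
by rewrite /= Ec Ed -scalemxAl -scalemxAr scalerA.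
Qed.
Lemma PGLinv_pi A : PGLinv (\pi_PGL A) = \pi_PGL A^-1%g.
Proof.
apply/PGL_eqP/GL_scalP; have [c c0 /= Ec] := PGL_reprP A.
exists c^-1; first by rewrite invr_eq0.
by rewrite /= Ec invmxZ // unitmxZ ?unitfE // GLmx_unit.
Qed.

Lemma PGLmulA : associative PGLmul.
Proof.
move=> s t u; rewrite -[s]reprK -[t]reprK -[u]reprK.
by rewrite (PGLmul_pi (repr t)) (PGLmul_pi (repr s) (repr t)) !PGLmul_pi mulgA.
Qed.
Lemma PGLmul1 : left_id PGL1 PGLmul.
Proof. by move=> s; rewrite -[s]reprK PGLmul_pi mul1g. Qed.
Lemma PGLmulr1 : right_id PGL1 PGLmul.
Proof. by move=> s; rewrite -[s]reprK PGLmul_pi mulg1. Qed.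
Lemma PGLmulV : left_inverse PGL1 PGLinv PGLmul.
Proof. by move=> s; rewrite -[s]reprK PGLinv_pi PGLmul_pi mulVg. Qed.
Lemma PGLmulrV : right_inverse PGL1 PGLinv PGLmul.
Proof. by move=> s; rewrite -[s]reprK PGLinv_pi PGLmul_pi mulgV. Qed.

HB.instance Definition _ :=
  isGroup.Build PGL PGLmulA PGLmul1 PGLmulr1 PGLmulV PGLmulrV.

Lemma PGL_piM A B : \pi_PGL (A * B)%g = (\pi_PGL A * \pi_PGL B)%g.
Proof. by rewrite -PGLmul_pi. Qed.
Lemma PGL_piV A : \pi_PGL A^-1%g = (\pi_PGL A)^-1%g.
Proof. by rewrite -PGLinv_pi. Qed.
Lemma PGL_pi1 : \pi_PGL 1%g = 1%g.
Proof. by []. Qed.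
End PGLDef.

(* [Proj k n] is P^n(k), with n.+1 homogeneous coordinates. *)
Record nzvec (k : fieldType) (n : nat) :=
  MkNzvec { nzv :> 'cV[k]_n.+1; nzv_neq0 : nzv != 0 }.

HB.instance Definition _ (k : fieldType) (n : nat) := [isSub for @nzv k n].
HB.instance Definition _ (k : fieldType) (n : nat) :=
  [Choice of nzvec k n by <:].

Section ProjDef.
Variables (k : fieldType) (n : nat).
Implicit Types u v w : nzvec k n.

Definition proportional u v : bool :=
  ((u : 'cV[k]_n.+1)^T == (v : 'cV[k]_n.+1)^T)%MS.

Lemma proportionalP u v :
  reflect (exists2 c : k, c != 0 & (u : 'cV[k]_n.+1) = c *: (v : 'cV[k]_n.+1))
          (proportional u v).
Proof.
apply: (iffP andP) => [[/sub_rVP [c Ec] _]|[c c0 Ec]].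
  have Euv : (u : 'cV[k]_n.+1) = c *: (v : 'cV[k]_n.+1).
    by apply: trmx_inj; rewrite Ec linearZ.
  exists c => //; apply: contraNneq (nzv_neq0 u) => c0.
  by rewrite Euv c0 scale0r.
split; apply/sub_rVP; first by exists c; rewrite Ec linearZ.
by exists c^-1; rewrite Ec linearZ /= scalerA mulVf ?scale1r.
Qed.

Lemma proportional_refl : reflexive proportional.
Proof. by move=> u; rewrite /proportional !submx_refl. Qed.
Lemma proportional_sym : ssrbool.symmetric proportional.
Proof. by move=> u v; rewrite /proportional andbC. Qed.
Lemma proportional_trans : transitive proportional.
Proof.
move=> v u w /andP[uv vu] /andP[vw wv]; apply/andP; split.
  exact: submx_trans uv vw.
exact: submx_trans wv vu.
Qed.

Canonical proportional_equiv :=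
  EquivRel proportional proportional_refl proportional_sym proportional_trans.

Definition Proj := {eq_quot proportional}.
HB.instance Definition _ := Choice.on Proj.
HB.instance Definition _ := EqQuotient.on Proj.

Lemma Proj_eqP u v : reflect (\pi_Proj u = \pi_Proj v) (proportional u v).
Proof. by rewrite -(eqquotE Proj); apply: eqP. Qed.

Lemma Proj_reprP u :
  exists2 c : k, c != 0 &
    (repr (\pi_Proj u) : 'cV[k]_n.+1) = c *: (u : 'cV[k]_n.+1).
Proof. by apply/proportionalP/Proj_eqP; rewrite reprK. Qed.

Lemma GLact_neq0 (A : GL k n.+1) v :
  (A : 'M[k]_n.+1) *m (v : 'cV[k]_n.+1) != 0.
Proof.
apply: contraNneq (nzv_neq0 v) => Av0.
by rewrite -[nzv v](mulKmx (GLmx_unit A)) Av0 mulmx0.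
Qed.
Definition GLact (A : GL k n.+1) v : nzvec k n := MkNzvec (GLact_neq0 A v).
Definition Pact (s : PGL k n.+1) (x : Proj) : Proj :=
  \pi_Proj (GLact (repr s) (repr x)).

Lemma Pact_pi (A : GL k n.+1) v :
  Pact (\pi_(PGL k n.+1) A) (\pi_Proj v) = \pi_Proj (GLact A v).
Proof.
apply/Proj_eqP/proportionalP.
have [c c0 /= Ec] := PGL_reprP A; have [d d0 /= Ed] := Proj_reprP v.
exists (c * d); first by rewrite mulf_neq0.
by rewrite /= Ec Ed -scalemxAl -scalemxAr scalerA.
Qed.

Lemma Pact1 (x : Proj) : Pact 1%g x = x.
Proof.
rewrite -[x]reprK -PGL_pi1 Pact_pi; congr (\pi_Proj _).
by apply: val_inj; rewrite /= mul1mx.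
Qed.
Lemma PactM (s t : PGL k n.+1) (x : Proj) : Pact (s * t)%g x = Pact s (Pact t x).
Proof.
rewrite -[x]reprK -[s]reprK -[t]reprK -PGL_piM.
rewrite (Pact_pi (repr t) (repr x)) (Pact_pi (repr s)) Pact_pi.
congr (\pi_Proj _).
by apply: val_inj; rewrite /= mulmxA.
Qed.
End ProjDef.

Definition stabPGL (k : fieldType) (n : nat) (S : {pred Proj k n}) :
    {pred PGL k n.+1} :=
  fun s => `[< forall x, (Pact s x \in S) = (x \in S) >].

Record AutProj (k : fieldType) (n : nat) (S : {pred Proj k n}) :=
  MkAutProj { autP :> PGL k n.+1; autP_stab : autP \in stabPGL S }.

HB.instance Definition _ (k : fieldType) (n : nat) (S : {pred Proj k n}) :=
  [isSub for @autP k n S].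
HB.instance Definition _ (k : fieldType) (n : nat) (S : {pred Proj k n}) :=
  [Choice of AutProj S by <:].

Lemma stabPGL_group (k : fieldType) (n : nat) (S : {pred Proj k n}) :
  group_closed (stabPGL S).
Proof.
split; first by apply/asboolP => x; rewrite Pact1.
move=> s t /asboolP Hs /asboolP Ht; apply/asboolP => x.
by rewrite PactM Hs -Ht -PactM mulgV Pact1.
Qed.

HB.instance Definition _ (k : fieldType) (n : nat) (S : {pred Proj k n}) :=
  SubChoice_isSubGroup.Build (PGL k n.+1) (stabPGL S) (AutProj S)
    (stabPGL_group S).

Definition evalv (k : fieldType) (n : nat) (p : {mpoly k[n]}) (v : 'cV[k]_n) : k :=
  p.@[fun i => v i 0].

(* [pullback A p] is the polynomial x |-> p (A x). *)
Definition pullback (k : fieldType) (n : nat) (A : 'M[k]_n) (p : {mpoly k[n]}) :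
    {mpoly k[n]} :=
  p \mPo [tuple \sum_(j < n) A i j *: 'X_j | i < n].

Section PullbackTheory.
Variables (k : fieldType) (n : nat).
Implicit Types (A B : 'M[k]_n) (p q : {mpoly k[n]}).

Lemma evalv_pullback A p v : evalv (pullback A p) v = evalv p (A *m v).
Proof.
rewrite /evalv /pullback comp_mpoly_meval; apply: meval_eq => i.
rewrite tnth_mktuple mxE raddf_sum /=; apply: eq_bigr => j _.
by rewrite mevalZ mevalXU.
Qed.

Lemma pullbackD A p q : pullback A (p + q) = pullback A p + pullback A q.
Proof. exact: comp_mpolyD. Qed.
Lemma pullbackM A p q : pullback A (p * q) = pullback A p * pullback A q.
Proof. by rewrite /pullback rmorphM. Qed.

Lemma pullback1 p : pullback 1%:M p = p.
Proof.
rewrite /pullback -[RHS]comp_mpoly_id; congr (_ \mPo _).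
apply: eq_mktuple => i; rewrite (bigD1 i) //= big1 ?addr0 => [|j ji].
  by rewrite mxE eqxx scale1r.
by rewrite mxE eq_sym (negPf ji) scale0r.
Qed.

Lemma pullback_mul A B p : pullback (A *m B) p = pullback B (pullback A p).
Proof.
rewrite [pullback A p]/pullback [in RHS]comp_mpolyEX /pullback raddf_sum /=.
rewrite [LHS]comp_mpolyEX; apply: eq_bigr => m _; rewrite comp_mpolyZ.
congr (_ *: _); rewrite !comp_mpolyX rmorph_prod /=.
apply: eq_bigr => i _; rewrite rmorphXn /=; congr (_ ^+ _).
rewrite !tnth_mktuple raddf_sum /=.
under [RHS]eq_bigr => l _ do
  rewrite comp_mpolyZ comp_mpolyXU -tnth_nth tnth_mktuple scaler_sumr.
rewrite exchange_big /=; apply: eq_bigr => j _.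
by rewrite mxE scaler_suml; apply: eq_bigr => l _; rewrite scalerA.
Qed.

Lemma pullbackZ_homog (c : k) A p d :
  p \is d.-homog -> pullback (c *: A) p = c ^+ d *: pullback A p.
Proof.
move=> /dhomogP hp; rewrite /pullback !comp_mpolyEX scaler_sumr.
rewrite !big_seq; apply: eq_bigr => m mp.
rewrite scalerA mulrC -scalerA; congr (_ *: _); rewrite !comp_mpolyX.
rewrite -(hp m mp) /= mdegE -prodrXr -scaler_prod.
apply: eq_bigr => i _; rewrite -exprZn !tnth_mktuple; congr (_ ^+ _).
by rewrite scaler_sumr; apply: eq_bigr => j _; rewrite mxE scalerA.
Qed.

Lemma evalvZ_homog (c : k) p d v :
  p \is d.-homog -> evalv p (c *: v) = c ^+ d * evalv p v.
Proof.
move=> hp; rewrite -mul_scalar_mx -evalv_pullback -scalemx1.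
by rewrite (pullbackZ_homog _ _ hp) pullback1 /evalv mevalZ.
Qed.
End PullbackTheory.

(* Quadratic forms in N variables are the elements of [dhomog N k 2], the
   homogeneous polynomials of degree 2 (zero included). *)
Section Quadrics.
Variables (k : fieldType) (n : nat) (f g : dhomog n.+1 k 2).
Implicit Types (x : Proj k n) (v : 'cV[k]_n.+1) (p : {mpoly k[n.+1]}).

Definition baseX : {pred Proj k n} :=
  fun x => (evalv f (repr x) == 0) && (evalv g (repr x) == 0).

(* Jacobian criterion: V(f, g) is smooth of codimension 2 iff df and dg are
   linearly independent at each of its k-points. *)
Definition jacobian v : 'M[k]_(2, n.+1) :=
  \matrix_(i < 2, j < n.+1)
    evalv (if i == 0 then f^`M(j) else g^`M(j)) v.

Definition smoothX : Prop :=
  forall x, x \in baseX -> \rank (jacobian (repr x)) = 2.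

Definition in_idealX p : Prop :=
  exists a b : {mpoly k[n.+1]}, p = a * mpoly_of_dhomog f + b * mpoly_of_dhomog g.

(* The elements of PGL_(n+1)(k) mapping the closed subscheme X onto itself:
   pulling back along a representing matrix preserves the ideal (f, g). *)
Definition stabX : {pred PGL k n.+1} :=
  fun s => `[< forall p, in_idealX (pullback (repr s : GL k n.+1) p)
                         <-> in_idealX p >].

Lemma in_idealXZ (c : k) p : in_idealX p -> in_idealX (pullback c%:M p).
Proof.
move=> [a [b ->]]; rewrite pullbackD !pullbackM -scalemx1.
rewrite !(pullbackZ_homog _ _ (dhomog_is_dhomog _)) !pullback1.
exists (c ^+ 2 *: pullback (c *: 1%:M) a), (c ^+ 2 *: pullback (c *: 1%:M) b).
by rewrite -!scalerAr -!scalerAl.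
Qed.

Lemma in_idealX_scale (c : k) A p : c != 0 ->
  in_idealX (pullback (c *: A) p) <-> in_idealX (pullback A p).
Proof.
move=> c0; split=> [H|H].
  have -> : A = (c *: A) *m (c^-1)%:M.
    by rewrite mul_mx_scalar scalerA mulVf ?scale1r.
  by rewrite pullback_mul; apply: in_idealXZ.
by rewrite -mul_mx_scalar pullback_mul; apply: in_idealXZ.
Qed.

Lemma stabXP (A : GL k n.+1) :
  reflect (forall p, in_idealX (pullback A p) <-> in_idealX p)
          (\pi_(PGL k n.+1) A \in stabX).
Proof.
have E p : in_idealX (pullback (repr (\pi_(PGL k n.+1) A) : GL k n.+1) p)
           <-> in_idealX (pullback A p).
  by have [c c0 /= ->] := PGL_reprP A; apply: in_idealX_scale.
apply: (iffP (asboolP _)) => H p.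
  exact: (iff_trans (iff_sym (E p)) (H p)).
exact: (iff_trans (E p) (H p)).
Qed.

Lemma stabX_group : group_closed stabX.
Proof.
split.
  by rewrite -PGL_pi1; apply/stabXP => p; rewrite pullback1.
move=> s t; rewrite -[s]reprK -[t]reprK => /stabXP Hs /stabXP Ht.
rewrite -PGL_piV -PGL_piM; apply/stabXP => p /=.
apply: iff_trans (Hs p); apply: iff_trans (iff_sym (Ht _)) _.
by rewrite -pullback_mul mulmxKV ?GLmx_unit.
Qed.

(* Aut_X(k) = pi_0(Aut_X), where Aut_X, finite in the range of interest (n odd,
   n >= 5), is viewed as a closed subgroup scheme of PGL_(n+1). *)
Record AutX := MkAutX { autX :> PGL k n.+1; autX_stab : autX \in stabX }.

HB.instance Definition _ := [isSub for autX].
HB.instance Definition _ := [Choice of AutX by <:].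
HB.instance Definition _ :=
  SubChoice_isSubGroup.Build (PGL k n.+1) stabX AutX stabX_group.

Record complX := MkComplX { cX :> Proj k n; cX_notin : cX \notin baseX }.

HB.instance Definition _ := [isSub for cX].
HB.instance Definition _ := [Choice of complX by <:].

Definition fg_vec v : 'cV[k]_2 :=
  \col_(i < 2) (if i == 0 then evalv f v else evalv g v).

Lemma fg_vec_eq0 v : (fg_vec v == 0) = (evalv f v == 0) && (evalv g v == 0).
Proof.
apply/eqP/andP => [/colP H|[/eqP Hf /eqP Hg]].
  by have := H 0; have := H 1; rewrite !mxE /= => -> ->.
by apply/colP => i; rewrite !mxE Hf Hg if_same.
Qed.

Lemma phi_neq0 (x : complX) : fg_vec (repr (cX x)) != 0.
Proof. by rewrite fg_vec_eq0; apply: cX_notin. Qed.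

Definition phi (x : complX) : Proj k 1 := \pi_(Proj k 1) (MkNzvec (phi_neq0 x)).

(* In the chart g <> 0 one has g^2 d(f/g) = g df - f dg, and symmetrically in
   the chart f <> 0, so these are the 1 x 1 minors which locally generate the
   (n-1)-st Fitting ideal of the relative differentials of phi. By Euler's
   relation \sum_j x_j (g df/dx_j - f dg/dx_j) = 2fg - 2fg = 0, using all n+1
   homogeneous coordinates is the same as using the n coordinates of an affine
   chart. *)
Definition dphi v : 'rV[k]_n.+1 :=
  \row_(j < n.+1) (evalv g v * evalv f^`M(j) v
                   - evalv f v * evalv g^`M(j) v).

Definition singZ : {pred complX} := fun x : complX => dphi (repr (cX x)) == 0.

Definition phiZ : {pred Proj k 1} :=
  fun y => `[< exists2 x : complX, x \in singZ & phi x = y >].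

Lemma evalX_scale (c : k) v : c != 0 ->
  (evalv f (c *: v) == 0) && (evalv g (c *: v) == 0)
  = (evalv f v == 0) && (evalv g v == 0).
Proof.
move=> c0; rewrite !(evalvZ_homog _ _ (dhomog_is_dhomog _)).
by rewrite !mulrI_eq0 //; apply/lregP; rewrite expf_neq0.
Qed.

Lemma baseX_pi (w : nzvec k n) :
  (\pi_(Proj k n) w \in baseX) = (evalv f w == 0) && (evalv g w == 0).
Proof.
by have [c c0 E] := Proj_reprP w; rewrite unfold_in E evalX_scale.
Qed.

Lemma in_idealX_eval p v :
  in_idealX p -> evalv f v = 0 -> evalv g v = 0 -> evalv p v = 0.
Proof.
move=> [a [b ->]] Ef Eg.
by rewrite /evalv rmorphD !rmorphM /= -/(evalv f v) -/(evalv g v) Ef Eg !mulr0 addr0.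
Qed.

Lemma in_idealX_f : in_idealX f.
Proof. by exists 1, 0; rewrite mul1r mul0r addr0. Qed.
Lemma in_idealX_g : in_idealX g.
Proof. by exists 0, 1; rewrite mul1r mul0r add0r. Qed.

Lemma stabX_baseX (s : PGL k n.+1) x :
  s \in stabX -> x \in baseX -> Pact s x \in baseX.
Proof.
rewrite -[s]reprK -[x]reprK Pact_pi !baseX_pi => /stabXP Hs /andP[/eqP Ef /eqP Eg].
rewrite /= -!evalv_pullback.
by apply/andP; split; apply/eqP; apply: in_idealX_eval => //; apply/Hs;
  [exact: in_idealX_f | exact: in_idealX_g].
Qed.

Lemma AutX_complX (s : AutX) (x : complX) : Pact s x \notin baseX.
Proof.
apply: contra (cX_notin x) => H.
have /stabX_baseX := autX_stab (s^-1)%g; move=> /(_ _ H).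
by rewrite -PactM [autX _]/= mulVg Pact1.
Qed.

Definition AutXact (s : AutX) (x : complX) : complX := MkComplX (AutX_complX s x).
End Quadrics.

Section Pfaffian.
Variables (k : fieldType) (n : nat).

Definition polar (q : {mpoly k[n]}) (u v : 'cV[k]_n) : k :=
  evalv q (u + v) - evalv q u - evalv q v.

Definition polar_mx (q : {mpoly k[n]}) : 'M[k]_n :=
  \matrix_(i, j) polar q (delta_mx i 0) (delta_mx j 0).

(* P(s, t) = Pf(s f - t g), with s = 'X_0 and t = 'X_1. In characteristic 2 the
   square root is unique. *)
Definition is_pfaffian (f g : {mpoly k[n]}) (P : {mpoly k[2]}) : Prop :=
  P ^+ 2 = \det ('X_0 *: map_mx (@mpolyC 2 k) (polar_mx f)
                 - 'X_1 *: map_mx (@mpolyC 2 k) (polar_mx g)).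

Definition has_distinct_roots (d : nat) (P : {mpoly k[2]}) : Prop :=
  exists r : 'I_d -> Proj k 1,
    injective r
    /\ forall y : Proj k 1, evalv P (repr y) = 0 <-> exists i, y = r i.

Definition pfaffian_distinct_roots (d : nat) (f g : {mpoly k[n]}) : Prop :=
  exists P : {mpoly k[2]}, is_pfaffian f g P /\ has_distinct_roots d P.
End Pfaffian.

(* Main.v *)
Require Import Defs.
From HB Require Import structures.
From mathcomp Require Import all_boot all_order all_fingroup all_algebra.
From mathcomp Require Import boolp.
From mathcomp Require Import mpoly generic_quotient ring.

Set Implicit Arguments.
Unset Strict Implicit.
Unset Printing Implicit Defensive.

Import GRing.Theory.
Local Open Scope ring_scope.
Local Open Scope quotient_scope.

(* For a root [s_i : t_i] of the Pfaffian, s_i f - t_i g has a singular alternating polar form;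
   alternating forms have even rank, so its radical is at least a plane, on which s_i f - t_i g is
   the square of a linear form and hence has a zero e_i. Smoothness of X makes e_i unique up to a
   scalar and allows the normalisation f(e_i) = t_i, g(e_i) = s_i. There are linear forms b_i with
   A_f(e_i, -) = t_i b_i and A_g(e_i, -) = s_i b_i. The e_i are eigenvectors of A_g A_h^-1 for a
   nondegenerate member h of the pencil, with distinct eigenvalues, so they are independent; they
   span a Lagrangian subspace, the common kernel of the b_i.

   The transvections v |-> v + b_i(v) e_i preserve f and g and generate (Z/2)^(M+1). Conversely an
   isometry of both f and g fixes every e_i and every b_i, so it has the form
   v |-> v + sum_ij W_ij b_j(v) e_i; comparing values of f and g forces W to be diagonal with
   W_ii^2 = W_ii. An element of the kernel of phi_* scales f and g by a common factor, which a
   scalar matrix removes. *)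

(** * Alternating matrices in characteristic 2 *)

Lemma addrr_char2 (k : nzRingType) (char2 : 2%N \in [pchar k]) (x : k) : x + x = 0.
Proof. exact: (addrr_pchar2 char2). Qed.

(** [s] exchanges [lo] and [hi], the points that it moves up and down in the enumeration of [T], so
    the points moved are even in number. *)
Lemma involution_fixed_point (T : finType) (s : {perm T}) :
  odd #|T| -> s^-1%g = s -> exists i, s i = i.
Proof.
move=> oddT sV.
suff: odd #|[set i | s i == i]|.
  case: (set_0Vmem [set i | s i == i]) => [->|[i]]; first by rewrite cards0.
  by rewrite inE => /eqP si _; exists i.
have sK i : s (s i) = i by rewrite -{1}sV permK.
pose lo := [set i | (enum_rank i < enum_rank (s i))%N].
pose hi := [set i | (enum_rank (s i) < enum_rank i)%N].
have cardlh : #|hi| = #|lo|.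
  have -> : hi = s @: lo.
    apply/setP => i; rewrite -[in RHS](sK i) mem_imset ?inE ?sK //; exact: perm_inj.
  by rewrite card_imset //; exact: perm_inj.
have : #|T| = (#|[set i | s i == i]| + (#|lo| + #|hi|))%N.
  rewrite -cardsT -(cardsID [set i | s i == i]); congr (_ + _)%N.
    by rewrite setTI.
  rewrite -cardsUI; have -> : lo :&: hi = set0.
    by apply/setP => i; rewrite !inE; case: ltngtP.
  rewrite cards0 addn0; apply: eq_card => i; rewrite !inE andbT.
  rewrite -neq_ltn; congr (~~ _).
  by rewrite -(inj_eq enum_rank_inj) -val_eqE /= eq_sym.
by move=> E; move: oddT; rewrite E cardlh addnn oddD odd_double addbF.
Qed.

Section Alternating.
Variables (k : fieldType) (char2 : 2%N \in [pchar k]).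

(* The terms of the Leibniz formula indexed by s and s^-1 cancel; a permutation with s = s^-1
   has a fixed point, which contributes a diagonal entry. *)
Lemma det_alternating_odd m (N : 'M[k]_m) :
  odd m -> N^T = N -> (forall i, N i i = 0) -> \det N = 0.
Proof.
move=> oddm symN diagN.
pose F (s : 'S_m) := (-1) ^+ s * \prod_i N i (s i) : k.
have FV s : F s^-1%g = F s.
  rewrite /F odd_permV; congr (_ * _).
  rewrite (reindex_inj (@perm_inj _ s)) /=; apply: eq_bigr => i _.
  by rewrite permK -{1}symN mxE.
rewrite /determinant -/F (bigID (fun s : 'S_m => s^-1 == s)%g) /=.
rewrite big1 => [|s /eqP sV]; last first.
  have [|i si] := involution_fixed_point _ sV; first by rewrite card_ord.
  by rewrite (bigD1 i) //= si diagN mul0r mulr0.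
rewrite add0r (bigID (fun s : 'S_m => enum_rank s < enum_rank s^-1%g)%N) /=.
set A := (X in X + _); set B := (X in _ + X).
suff -> : B = A by apply: addrr_char2.
rewrite /A /B (reindex_inj invg_inj) /=; apply: eq_big => [s|s _]; last exact: FV.
rewrite !invgK eq_sym; case: eqVneq => //= sV.
rewrite -leqNgt leq_eqVlt; case: eqP => //= /val_inj /enum_rank_inj E.
by rewrite -E eqxx in sV.
Qed.

(** Deleting row and column [j], where [v] has a nonzero entry, leaves an alternating matrix of odd
    size [n], hence a kernel vector. Extended by 0 at [j], it satisfies every equation but the
    [j]-th, which follows by pairing with [v]. Coordinate [j] separates the two vectors. *)
Lemma alternating_ker2 n (N : 'M[k]_n.+1) :
  odd n -> N^T = N -> (forall i, N i i = 0) -> \det N = 0 ->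
  exists v w : 'cV[k]_n.+1, [/\ N *m v = 0, N *m w = 0 &
    forall a b, a *: v + b *: w = 0 -> a = 0 /\ b = 0].
Proof.
move=> oddn symN diagN /eqP/det0P[v v0 vN].
have [j vj] : exists j, v 0 j != 0.
  by apply/existsP; apply: contra_neqT v0; rewrite negb_exists => /forallP H;
     apply/rowP => j; have := H j; rewrite negbK mxE => /eqP.
pose D := row' j (col' j N).
have D0 : \det D = 0.
  apply: det_alternating_odd => // [|i]; last by rewrite !mxE.
  by apply/matrixP => a b; rewrite !mxE -{1}symN mxE.
have /det0P[w w0 wD] : \det D == 0 by apply/eqP.
pose w' : 'rV[k]_n.+1 := \row_i oapp (fun l => w 0 l) 0 (unlift j i).
have w'j : w' 0 j = 0 by rewrite mxE unlift_none.
have w'l l : w' 0 (lift j l) = w 0 l by rewrite mxE liftK.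
have w'Nl l : (w' *m N) 0 (lift j l) = 0.
  rewrite mxE (bigD1_ord j) //= w'j mul0r add0r.
  transitivity ((w *m D) 0 l); last by rewrite wD mxE.
  by rewrite [RHS]mxE; apply: eq_bigr => i _; rewrite w'l /D !mxE.
have w'N : w' *m N = 0.
  have E : w' *m N *m v^T = 0.
    by rewrite -mulmxA -[N]symN -trmx_mul vN trmx0 mulmx0.
  apply/rowP => i; case: (unliftP j i) => [l|] ->; first by rewrite w'Nl mxE.
  move/matrixP/(_ 0 0): E; rewrite mxE (bigD1_ord j) //= big1 => [|l _].
    by rewrite addr0 !mxE => /eqP; rewrite mulf_eq0 (negPf vj) orbF => /eqP.
  by rewrite w'Nl mul0r.
exists v^T, w'^T; split.
- by rewrite -{1}[N]symN -trmx_mul vN trmx0.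
- by rewrite -{1}[N]symN -trmx_mul w'N trmx0.
move=> a b E.
have a0 : a = 0.
  move/matrixP/(_ j 0): E; rewrite !mxE unlift_none /= mulr0 addr0 => /eqP.
  by rewrite mulf_eq0 (negPf vj) orbF => /eqP.
split=> //; move: E; rewrite a0 scale0r add0r => /eqP; rewrite scaler_eq0 => /orP[/eqP//|].
move=> /eqP w'0; case/eqP: w0; apply/rowP => l.
by rewrite -w'l -[w']trmxK w'0 !mxE.
Qed.
End Alternating.

(** * Quadratic forms *)

Section QuadraticPolynomials.
Variables (k : fieldType) (n : nat).
Implicit Types (S : 'M[k]_n) (p : {mpoly k[n]}) (u v w : 'cV[k]_n).

(** The matrix is arbitrary because in characteristic 2 symmetric matrices yield only diagonal
    forms. It is not determined by the form, but [S + S^T], the matrix of the polar form, is. *)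
Definition qpoly S : {mpoly k[n]} := \sum_i \sum_j S i j *: ('X_i * 'X_j).

Lemma qpoly_is_linear : linear qpoly.
Proof.
move=> c S S'; rewrite /qpoly scaler_sumr -big_split; apply: eq_bigr => i _ /=.
rewrite scaler_sumr -big_split; apply: eq_bigr => j _ /=.
by rewrite !mxE scalerDl scalerA.
Qed.
HB.instance Definition _ := GRing.isLinear.Build k 'M[k]_n {mpoly k[n]} _ qpoly qpoly_is_linear.

Lemma qpoly_delta i j : qpoly (delta_mx i j) = 'X_i * 'X_j.
Proof.
rewrite /qpoly (bigD1 i) //= (bigD1 j) //= !mxE !eqxx scale1r.
rewrite [X in _ + X]big1 => [|l li]; last first.
  by rewrite big1 // => m _; rewrite mxE (negPf li) scale0r.
rewrite big1 ?addr0 // => l lj; by rewrite mxE (negPf lj) andbF scale0r.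
Qed.

Lemma qpolyP p : p \is 2.-homog -> exists S, p = qpoly S.
Proof.
move=> /dhomogP hp; rewrite [p]mpolyE.
pose A (q : {mpoly k[n]}) := exists S, q = qpoly S.
rewrite -/(A _) big_seq; apply: (big_ind A).
- by exists 0; rewrite linear0.
- by move=> _ _ [S ->] [S' ->]; exists (S + S'); rewrite linearD.
move=> m /hp; rewrite -/(A _) /= => md.
have [i mi] : exists i, (0 < m i)%N.
  apply/existsP; apply: contra_eqT md; rewrite negb_exists => /forallP H.
  by rewrite mdegE big1 // => i _; apply/eqP; rewrite -leqn0 leqNgt H.
have mE : m = (U_(i) + (m - U_(i)))%MM.
  by rewrite addmC submK // lep1mP -lt0n.
have : mdeg (m - U_(i)) == 1%N.
  by rewrite -eqSS -md [in X in _ == X]mE mdegD mdeg1 add1n.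
case/mdeg1P => j /eqP Ej.
exists (p@_m *: delta_mx i j); rewrite linearZ /= qpoly_delta.
by rewrite -mpolyXD -Ej -mE.
Qed.

Lemma evalv_qpoly S v : evalv (qpoly S) v = (v^T *m S *m v) 0 0.
Proof.
rewrite /evalv /qpoly raddf_sum /= mxE.
under [RHS]eq_bigr => j _ do rewrite mxE big_distrl /=.
rewrite exchange_big; apply: eq_bigr => i _; rewrite raddf_sum /=; apply: eq_bigr => j _.
by rewrite mevalZ rmorphM /= !mevalXU mxE mulrCA mulrA.
Qed.

Lemma pullback_qpoly (A : 'M[k]_n) S : pullback A (qpoly S) = qpoly (A^T *m S *m A).
Proof.
have lin_pb c p q : pullback A (c *: p + q) = c *: pullback A p + pullback A q.
  by rewrite pullbackD /pullback comp_mpolyZ.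
have pb0 : pullback A 0 = 0 by rewrite /pullback comp_mpoly0.
rewrite [S]matrix_sum_delta.
have L i j : qpoly (A^T *m delta_mx i j *m A) = pullback A ('X_i * 'X_j).
  rewrite pullbackM /pullback !comp_mpolyXU -!tnth_nth !tnth_mktuple /qpoly.
  rewrite big_distrl /=; apply: eq_bigr => a _.
  rewrite big_distrr /=; apply: eq_bigr => b _.
  rewrite -scalerAl -scalerAr scalerA; congr (_ *: _).
  rewrite mxE (bigD1 j) //= big1 => [|l lj].
    rewrite addr0 mxE (bigD1 i) //= big1 => [|l li]; last first.
      by rewrite !mxE (negPf li) mulr0.
    by rewrite addr0 !mxE !eqxx mulr1.
  by rewrite mxE big1 ?mul0r // => m _; rewrite mxE [delta_mx _ _ _ _]mxE (negPf lj) andbF mulr0.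
have big_lin I (r : seq I) (P : pred I) (F : I -> 'M[k]_n) :
    (forall i, pullback A (qpoly (F i)) = qpoly (A^T *m F i *m A)) ->
    pullback A (qpoly (\sum_(i <- r | P i) F i)) =
    qpoly (A^T *m (\sum_(i <- r | P i) F i) *m A).
  move=> H; elim/big_rec: _ => [|i x Pi IH]; first by rewrite mulmx0 mul0mx !linear0 pb0.
  by rewrite linearD pullbackD H IH mulmxDr mulmxDl linearD.
apply: (big_lin) => i; apply: (big_lin) => j.
by rewrite linearZ /= -[_ *: _]addr0 lin_pb pb0 addr0 -scalemxAr -scalemxAl linearZ /= L qpoly_delta.
Qed.

Lemma mderivXU (i j : 'I_n) : ('X_i : {mpoly k[n]})^`M(j) = (i == j)%:R%:MP.
Proof.
rewrite mderivX mnm1E; case: eqVneq => [->|_]; last by rewrite scale0r raddf0.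
by rewrite scale1r -[X in (X - _)%MM]add0m addmK mpolyX0.
Qed.

Lemma mderiv_qpoly S j v : evalv (qpoly S)^`M(j) v = ((S + S^T) *m v) j 0.
Proof.
have -> : (qpoly S)^`M(j) = \sum_i \sum_l S i l *: ((i == j)%:R%:MP * 'X_l + 'X_i * (l == j)%:R%:MP).
  rewrite /qpoly raddf_sum; apply: eq_bigr => i _; rewrite raddf_sum; apply: eq_bigr => l _.
  by rewrite /= mderivZ mderivM !mderivXU.
rewrite /evalv raddf_sum /=.
under eq_bigr => i _.
  rewrite raddf_sum /=.
  under eq_bigr => l _.
    rewrite mevalZ mevalD !mevalM !mevalC !mevalXU mulrDr; over.
  rewrite big_split /=; over.
rewrite big_split /= mulmxDl mxE; congr (_ + _).
  rewrite (bigD1 j) //= [X in _ + X]big1 => [|i ij].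
    by rewrite addr0 mxE; apply: eq_bigr => l _; rewrite eqxx mul1r.
  by rewrite big1 // => l _; rewrite (negPf ij) mul0r mulr0.
rewrite mxE; apply: eq_bigr => i _; rewrite (bigD1 j) //= big1 => [|l lj].
  by rewrite addr0 eqxx mulr1 mxE.
by rewrite (negPf lj) !mulr0.
Qed.

Lemma qpoly_dhomog S : qpoly S \is 2.-homog.
Proof.
apply: rpred_sum => i _; apply: rpred_sum => j _; apply: rpredZ.
by rewrite -mpolyXD dhomogX /= mdegD !mdeg1.
Qed.

Lemma polar_qpoly S u v : polar (qpoly S) u v = (u^T *m (S + S^T) *m v) 0 0.
Proof.
rewrite /polar !evalv_qpoly [(u + v)^T]linearD /= !mulmxDl !mulmxDr !mulmxDl.
have -> : (u^T *m S^T *m v) = (v^T *m S *m u)^T by rewrite !trmx_mul trmxK mulmxA.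
have addE (X Y : 'M[k]_1) : (X + Y) 0 0 = X 0 0 + Y 0 0 by rewrite mxE.
have trE (X : 'M[k]_1) : X^T 0 0 = X 0 0 by rewrite mxE.
by rewrite !addE trE; ring.
Qed.
End QuadraticPolynomials.

Section QuadraticForms.
Variables (k : fieldType) (n : nat) (p : {mpoly k[n]}) (hp : p \is 2.-homog).
Implicit Types (u v w : 'cV[k]_n).

Lemma polar_mxE u v : polar p u v = (u^T *m polar_mx p *m v) 0 0.
Proof.
have [S ->] := qpolyP hp; rewrite polar_qpoly; congr ((_ *m _ *m _) _ _).
apply/matrixP => i j; rewrite [RHS]mxE polar_qpoly trmx_delta -rowE.
by rewrite -colE !mxE.
Qed.

Lemma mderiv_polar i v : evalv p^`M(i) v = (polar_mx p *m v) i 0.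
Proof.
transitivity (polar p (delta_mx i 0) v); last first.
  by rewrite polar_mxE trmx_delta -mulmxA -rowE mxE.
have [S ->] := qpolyP hp; rewrite polar_qpoly mderiv_qpoly.
by rewrite trmx_delta -mulmxA -rowE [RHS]mxE.
Qed.

Lemma polarC u v : polar p u v = polar p v u.
Proof. by rewrite /polar [u + v]addrC addrAC. Qed.

Lemma polar_mx_sym : (polar_mx p)^T = polar_mx p.
Proof. by apply/matrixP => i j; rewrite !mxE polarC. Qed.

Lemma polarZr c u v : polar p u (c *: v) = c * polar p u v.
Proof. by rewrite !polar_mxE -scalemxAr mxE. Qed.

Lemma evalvD u v : evalv p (u + v) = evalv p u + evalv p v + polar p u v.
Proof. by rewrite /polar; ring. Qed.

Lemma polarvv u : polar p u u = evalv p u *+ 2.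
Proof.
rewrite /polar -mulr2n -scaler_nat (evalvZ_homog _ _ hp).
ring.
Qed.

Lemma dhomog2_pullback (A : 'M[k]_n) : pullback A p \is 2.-homog.
Proof. by have [S ->] := qpolyP hp; rewrite pullback_qpoly qpoly_dhomog. Qed.

(** This holds over finite fields too: the values at basis vectors kill the diagonal of [D], and the
    polar form kills [D i j + D j i], the coefficient of ['X_i * 'X_j] for i != j. *)
Lemma eq_dhomog2 q : q \is 2.-homog -> (forall v, evalv p v = evalv q v) -> p = q.
Proof.
move=> hq E; have [S pE] := qpolyP hp; have [S' qE] := qpolyP hq.
apply/eqP; rewrite -subr_eq0 pE qE -linearB /=; apply/eqP.
set D := S - S'.
have D0 v : (v^T *m D *m v) 0 0 = 0.
  by rewrite -evalv_qpoly /D linearB /= -pE -qE /evalv mevalB -!/(evalv _ _) E subrr.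
have pol0 u v : (u^T *m (D + D^T) *m v) 0 0 = 0.
  by rewrite -polar_qpoly /polar !evalv_qpoly !D0 !subrr.
have entry (B : 'M[k]_n) i j : ((delta_mx i 0 : 'cV[k]_n)^T *m B *m (delta_mx j 0 : 'cV[k]_n)) 0 0 = B i j.
  by rewrite trmx_delta -rowE -colE !mxE.
have diag i : D i i = 0 by rewrite -entry D0.
have sym i j : D i j + D j i = 0.
  by have := pol0 (delta_mx i 0) (delta_mx j 0); rewrite entry !mxE.
rewrite /qpoly pair_bigA /=.
rewrite (bigID (fun ij : 'I_n * 'I_n => ij.1 <= ij.2)%N) /=.
rewrite (bigID (fun ij : 'I_n * 'I_n => ij.1 == ij.2)%N) /=.
rewrite big1 => [|[i j] /= /andP[_ /eqP->]]; last by rewrite diag scale0r.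
(* The terms below the diagonal are folded onto those above it. *)
rewrite add0r [X in _ + X](reindex_inj (h := fun ij : 'I_n * 'I_n => (ij.2, ij.1))) /=; last first.
  by move=> [a b] [c d] /= [-> ->].
rewrite (eq_bigl (fun ij : 'I_n * 'I_n => ij.1 < ij.2)%N) => [|[i j] /=]; last first.
  by rewrite ltn_neqAle andbC.
rewrite [X in _ + X](eq_bigl (fun ij : 'I_n * 'I_n => ij.1 < ij.2)%N) => [|[i j] /=]; last first.
  by rewrite ltnNge.
rewrite -big_split big1 // => -[i j] _ /=.
by rewrite ['X_j * _]mulrC -scalerDl sym scale0r.
Qed.
End QuadraticForms.

(** * Singular vectors of a pencil *)

(** The polynomial [p] equals 1 at the points of [s], so its roots lie outside; for empty [s] it is
    constant and 0 is taken instead. *)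
Lemma closed_field_avoid (k : closedFieldType) (s : seq k) : exists c, c \notin s.
Proof.
pose p := \prod_(z <- s) ('X - z%:P) + 1.
case: s @p => [|z s] p; first by exists 0.
have sp : size p = (size s).+2.
  by rewrite /p size_polyDl size_prod_XsubC // size_poly1.
have [c /rootP pc] := @closed_rootP k p ltac:(by rewrite sp).
exists c; apply: contra_eqN pc; rewrite /p hornerD hornerC -root_prod_XsubC => /rootP ->.
by rewrite add0r oner_eq0.
Qed.

Lemma closed_field_quadratic (k : closedFieldType) (a b c : k) :
  a != 0 -> exists x, a * x ^+ 2 + b * x + c = 0.
Proof.
move=> a0; pose p := Poly [:: c; b; a].
have sp : size p = 3 by rewrite /p (@PolyK _ 1).
have [x /rootP px] := @closed_rootP k p ltac:(by rewrite sp).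
by exists x; rewrite -[RHS]px horner_Poly /=; ring.
Qed.

(** The left kernel of [D] has dimension 2m - m = m, so it is exactly the row space of [A]. *)
Lemma mulmx0_factor (k : fieldType) n m (A : 'M[k]_(m, n)) (D : 'M[k]_(n, m)) p
    (Y : 'M[k]_(p, n)) :
  n = (m + m)%N -> A *m D = 0 -> \rank A = m -> \rank D = m -> Y *m D = 0 ->
  exists Z, Y = Z *m A.
Proof.
move=> nE AD rA rD YD; apply/submxP.
have sAD : (A <= kermx D)%MS by apply/sub_kermxP.
apply: submx_trans (_ : kermx D <= A)%MS; first by apply/sub_kermxP.
by rewrite -(geq_leqif (mxrank_leqif_sup sAD)) mxrank_ker rA rD nE addnK.
Qed.

(* For v outside X: v represents a point of Z lying over [t : s]. *)
Definition sing_vec (k : fieldType) n (f g : {mpoly k[n]}) (s t : k) (v : 'cV[k]_n) : Prop :=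
  s *: (polar_mx f *m v) = t *: (polar_mx g *m v) /\ s * evalv f v = t * evalv g v.

Lemma proportional_pair (k : fieldType) (s t x y : k) :
  (s != 0) || (t != 0) -> s * x = t * y -> exists mu, x = mu * t /\ y = mu * s.
Proof.
have [s0 /= t0|s0 _] := eqVneq s 0 => E; last first.
  by exists (y / s); rewrite divfK //; split=> //; apply: (mulfI s0); rewrite E; field.
exists (x / t); rewrite divfK //; split=> //; apply: (mulfI t0).
by rewrite -E s0; ring.
Qed.

Lemma polar_mulmx (k : fieldType) n (p : {mpoly k[n]}) u v :
  p \is 2.-homog -> polar p u v = (u^T *m (polar_mx p *m v)) 0 0.
Proof. by move=> hp; rewrite polar_mxE // mulmxA. Qed.

Section SingularPoints.
Variables (k : closedFieldType) (char2 : 2%N \in [pchar k]).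
Variables (n : nat) (f g : dhomog n.+1 k 2).
Hypotheses (oddn : odd n) (X_smooth : smoothX f g).
Let hf : mpoly_of_dhomog f \is 2.-homog := dhomog_is_dhomog f.
Let hg : mpoly_of_dhomog g \is 2.-homog := dhomog_is_dhomog g.

(** At a point of X the hypothesis would be a linear relation between the rows df and dg of the
    Jacobian, which smoothness forbids. *)
Lemma smoothX_vec (s t : k) (v : 'cV[k]_n.+1) :
  (s != 0) || (t != 0) -> s *: (polar_mx f *m v) = t *: (polar_mx g *m v) ->
  evalv f v = 0 -> evalv g v = 0 -> v = 0.
Proof.
move=> st0 E fv gv; apply/eqP; apply: contraT => v0.
pose x := \pi_(Proj k n) (MkNzvec v0).
have Xx : x \in baseX f g by rewrite baseX_pi /= fv gv eqxx.
have /= [c c0 Ec] := Proj_reprP (MkNzvec v0).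
have := X_smooth Xx; rewrite Ec => /eqP rJ.
have freeJ : row_free (jacobian f g (c *: v)) by [].
pose r : 'rV[k]_2 := \row_i (if i == 0 then s else - t).
have : r *m jacobian f g (c *: v) = 0.
  apply/rowP => j; rewrite mxE !big_ord_recl big_ord0 addr0 !mxE /=.
  rewrite !mderiv_polar // -!scalemxAr ![(c *: (_ : 'cV[k]_n.+1)) _ _]mxE.
  have /matrixP/(_ j 0) := E; rewrite ![(_ *: (_ : 'M[k]_(_, _))) _ _]mxE => Ej.
  by rewrite mulrCA Ej mulNr mulrCA subrr.
move/eqP; rewrite mulmx_free_eq0 // => /eqP/rowP r0.
have := r0 0; have := r0 1; rewrite !mxE /= => /eqP; rewrite oppr_eq0 => /eqP t0 s0.
by rewrite s0 t0 eqxx in st0.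
Qed.

Lemma sing_polar s t u v :
  s *: (polar_mx f *m v) = t *: (polar_mx g *m v) -> s * polar f u v = t * polar g u v.
Proof.
move=> E; rewrite !polar_mulmx //.
have : s *: (u^T *m (polar_mx f *m v)) = t *: (u^T *m (polar_mx g *m v)).
  by rewrite scalemxAr E -scalemxAr.
by move/matrixP/(_ 0 0); rewrite ![(_ *: (_ : 'M[k]_(_, _))) _ _]mxE.
Qed.

Lemma evalv_addZ (p : {mpoly k[n.+1]}) u v b :
  p \is 2.-homog -> evalv p (u + b *: v) = evalv p v * b ^+ 2 + polar p u v * b + evalv p u.
Proof. by move=> hp; rewrite evalvD // (evalvZ_homog _ _ hp) polarZr //; ring. Qed.

(** On the radical of s A_f - t A_g the form s f - t g has zero polar form, so it is additive there
    and its zeros are closed under such combinations. *)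
Lemma sing_vec_add s t u v b :
  sing_vec f g s t u -> sing_vec f g s t v -> sing_vec f g s t (u + b *: v).
Proof.
move=> [u1 u2] [v1 v2]; split.
  by rewrite !mulmxDr !scalerDr u1 -!scalemxAr !scalerA ![_ * b]mulrC -!scalerA v1.
have E := sing_polar u v1.
rewrite !evalv_addZ //.
have -> : s * (evalv f v * b ^+ 2 + polar f u v * b + evalv f u) =
  (s * evalv f v) * b ^+ 2 + (s * polar f u v) * b + s * evalv f u by ring.
by rewrite E u2 v2; ring.
Qed.

(* A pencil of binary forms proportional on the span of two singular vectors would have a common
   zero there, which would be a singular point of X. *)
Lemma sing_vec_unique s t u v :
  (s != 0) || (t != 0) -> v != 0 -> sing_vec f g s t u -> sing_vec f g s t v ->
  exists c, u = c *: v.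
Proof.
move=> st0 v0 su sv.
suff [b fb gb] : exists2 b, evalv f (u + b *: v) = 0 & evalv g (u + b *: v) = 0.
  exists (- b); apply/eqP; rewrite scaleNr -addr_eq0; apply/eqP.
  by have [E _] := sing_vec_add b su sv; apply: smoothX_vec E fb gb.
have [E _] := sv; have [mv [fv gv]] := proportional_pair st0 sv.2.
have [mu [fu gu]] := proportional_pair st0 su.2.
have [b [fuv guv]] := proportional_pair st0 (sing_polar u E).
have mv0 : mv != 0.
  apply: contraNneq v0 => m0; rewrite m0 !mul0r in fv gv.
  by rewrite (smoothX_vec st0 E fv gv).
have [x xE] := closed_field_quadratic b mu mv0.
exists x; rewrite evalv_addZ //.
  by rewrite fv fuv fu -[RHS](mul0r t) -xE; ring.
by rewrite gv guv gu -[RHS](mul0r s) -xE; ring.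
Qed.

(** The form s f - t g is additive on a radical of dimension at least 2, so it has a nonzero zero e
    there. By smoothness (f(e), g(e)) = mu (t, s) with mu nonzero, and a square root of 1/mu
    normalises e. *)
Lemma sing_vec_exists s t :
  (s != 0) || (t != 0) -> \det (s *: polar_mx f - t *: polar_mx g) = 0 ->
  exists e, [/\ e != 0, sing_vec f g s t e, evalv f e = t & evalv g e = s].
Proof.
move=> st0; set N := _ - _ => N0.
have symN : N^T = N by rewrite /N linearB /= !linearZ /= !polar_mx_sym.
have diagp (p : {mpoly k[n.+1]}) i : p \is 2.-homog -> polar_mx p i i = 0.
  by move=> hp; rewrite mxE polarvv // mulr2n addrr_char2.
have diagN i : N i i = 0.
  have addE (A B : 'M[k]_n.+1) (a b : k) : (a *: A - b *: B) i i = a * A i i - b * B i i.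
    by rewrite !mxE.
  by rewrite addE !diagp // !mulr0 subrr.
have [v [w [Nv Nw indep]]] := alternating_ker2 char2 oddn symN diagN N0.
have NE u : N *m u = 0 -> s *: (polar_mx f *m u) = t *: (polar_mx g *m u).
  by move=> /eqP; rewrite mulmxBl -!scalemxAl subr_eq0 => /eqP.
suff [e e0 se] : exists2 e, e != 0 & sing_vec f g s t e.
  have [mu [fe ge]] := proportional_pair st0 se.2.
  have mu0 : mu != 0.
    apply: contraNneq e0 => m0; rewrite m0 !mul0r in fe ge.
    by rewrite (smoothX_vec st0 se.1 fe ge).
  have [x xE] := closed_field_quadratic 0 (-1) mu0.
  have {}xE : mu * x ^+ 2 = 1 by apply/eqP; rewrite -subr_eq0 -xE; apply/eqP; ring.
  have x0 : x != 0 by apply: contra_eqN xE => /eqP ->; rewrite expr0n mulr0 eq_sym oner_eq0.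
  exists (x *: e); split.
  - by rewrite scaler_eq0 negb_or x0.
  (* The zero vector is singular, and [x *: e] is [0 + x *: e]. *)
  - by rewrite -[x *: e]add0r; apply: sing_vec_add se;
      split; rewrite ?mulmx0 ?scaler0 // -(scale0r (0 : 'cV[k]_n.+1));
      rewrite !(evalvZ_homog _ _ hf, evalvZ_homog _ _ hg) expr0n !mul0r !mulr0.
  - by rewrite (evalvZ_homog _ _ hf) fe mulrA [_ * mu]mulrC xE mul1r.
  by rewrite (evalvZ_homog _ _ hg) ge mulrA [_ * mu]mulrC xE mul1r.
pose Q u := s * evalv f u - t * evalv g u.
have Q0 u : N *m u = 0 -> Q u = 0 -> sing_vec f g s t u.
  by move=> /NE Nu /eqP; rewrite subr_eq0 => /eqP.
have [Qw|Qw] := eqVneq (Q w) 0.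
  exists w; last exact: Q0.
  apply/eqP => w0; have [|_ /eqP] := indep 0 1; first by rewrite w0 scale0r scaler0 addr0.
  by rewrite oner_eq0.
(* Additivity on the radical gives Q(v + b w) = Q(v) + b^2 Q(w). *)
have [b bE] := closed_field_quadratic 0 (Q v) Qw.
exists (v + b *: w).
  apply/eqP => v0; have [|/eqP] := indep 1 b; first by rewrite scale1r.
  by rewrite oner_eq0.
apply: Q0; first by rewrite mulmxDr -scalemxAr Nv Nw scaler0 addr0.
have E := sing_polar v (NE _ _ Nw).
rewrite -[RHS]bE /Q !evalv_addZ //; apply/eqP; rewrite -subr_eq0; apply/eqP.
transitivity ((s * polar f v w - t * polar g v w) * b); first by ring.
by rewrite E subrr mul0r.
Qed.
End SingularPoints.

(** * Isometries of a pencil adapted to a Lagrangian frame *)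

(* The columns of E are the e_i and the rows of b the linear forms b_i. *)
Definition adapted (k : fieldType) (n m : nat) (E : 'M[k]_(n, m)) (b : 'M[k]_(m, n))
    (p : {mpoly k[n]}) (c : 'I_m -> k) : Prop :=
  [/\ p \is 2.-homog, forall i, evalv p (col i E) = c i
    & forall i v, polar p (col i E) v = c i * (b *m v) i 0].

Lemma mulmx_col_sum (k : fieldType) n m (E : 'M[k]_(n, m)) (x : 'cV[k]_m) :
  E *m x = \sum_i x i 0 *: col i E.
Proof.
apply/colP => j; rewrite mxE summxE; apply: eq_bigr => i _.
by rewrite !mxE mulrC.
Qed.

Section AdaptedFrame.
Variables (k : fieldType) (char2 : 2%N \in [pchar k]).
Variables (n m : nat) (E : 'M[k]_(n, m)) (b : 'M[k]_(m, n)).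
Hypothesis bE0 : b *m E = 0.

(** The columns of [E] are added one at a time: since b E = 0 the values b_i(v) do not change, and
    each column contributes c_i (x_i^2 + x_i b_i(v)). *)
Lemma adapted_eval p c v x : adapted E b p c ->
  evalv p (v + E *m x) =
  evalv p v + \sum_i c i * (x i 0 ^+ 2 + x i 0 * (b *m v) i 0).
Proof.
move=> [hp pE polE]; rewrite mulmx_col_sum.
elim: (index_enum _) v => [|i r IH] v; first by rewrite !big_nil !addr0.
rewrite !big_cons addrA IH addrA.
have -> : b *m (v + x i 0 *: col i E) = b *m v.
  by rewrite mulmxDr -scalemxAr colE mulmxA bE0 mul0mx scaler0 addr0.
congr (_ + _); rewrite evalvD // (evalvZ_homog _ _ hp) pE polarZr // polarC polE.
by ring.
Qed.

(** For d in {0,1}^m and b E = 0 this is the product of the commuting transvections v |-> v + b_i(v)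
    e_i with d_i = 1. *)
Definition frame_mx (d : 'rV[k]_m) : 'M[k]_n := 1%:M + E *m diag_mx d *m b.

Lemma frame_mx_mul d d' : frame_mx d *m frame_mx d' = frame_mx (d + d').
Proof.
rewrite /frame_mx mulmxDl mul1mx mulmxDr mulmx1 linearD /= mulmxDr mulmxDl.
rewrite -!mulmxA [b *m (E *m _)]mulmxA bE0 mul0mx !mulmx0 addr0.
by rewrite -addrA; congr (_ + _); rewrite addrC.
Qed.

(** With x_i = d_i b_i(v), the term x_i^2 + x_i b_i(v) is 0 or 2 b_i(v)^2, and both vanish in
    characteristic 2. *)
Lemma adapted_frame_mx p c (d : 'rV[k]_m) v : adapted E b p c ->
  (forall i, d 0 i = 0 \/ d 0 i = 1) -> evalv p (frame_mx d *m v) = evalv p v.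
Proof.
move=> pP d01; rewrite /frame_mx mulmxDl mul1mx -!mulmxA.
rewrite (adapted_eval _ _ pP) big1 ?addr0 // => i _.
have -> : (diag_mx d *m (b *m v)) i 0 = d 0 i * (b *m v) i 0 by rewrite mul_diag_mx mxE.
set x := (b *m v) i 0.
case: (d01 i) => ->; first by rewrite !mul0r expr0n addr0 mulr0.
by rewrite !mul1r -expr2 addrr_char2 // mulr0.
Qed.

Hypotheses (nE : n = (m + m)%N) (rankE : \rank E = m) (rankb : \rank b = m).
Variables (f g : {mpoly k[n]}) (t s : 'I_m -> k).
Hypotheses (fP : adapted E b f t) (gP : adapted E b g s).
Hypothesis st_indep : forall i j, i != j -> s i * t j != s j * t i.
Hypothesis st_neq0 : forall i, (s i != 0) || (t i != 0).

Lemma pencil_cancel i (x : k) : t i * x = 0 -> s i * x = 0 -> x = 0.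
Proof.
move=> /eqP; rewrite mulf_eq0 => /orP[/eqP ti|/eqP//] /eqP.
rewrite mulf_eq0 => /orP[/eqP si|/eqP//].
by have := st_neq0 i; rewrite si ti eqxx.
Qed.

Lemma adapted_surj (x : 'cV[k]_m) : exists v, b *m v = x.
Proof.
have /row_freeP[B bB] : row_free b by rewrite /row_free rankb.
by exists (B *m x); rewrite mulmxA bB mul1mx.
Qed.

(** As [b] is surjective, invariance says that the quadratic form sum_i c_i ((W x)_i^2 + (W x)_i
    x_i) vanishes at every x. Its values at basis vectors give the second relation; its polar form,
    to which the squares contribute nothing in characteristic 2, gives the first. *)
Lemma frame_invariance_relations (p : {mpoly k[n]}) c (W : 'M[k]_m) : adapted E b p c ->
  (forall v, evalv p (v + E *m (W *m (b *m v))) = evalv p v) ->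
  (forall i j, i != j -> c i * W i j + c j * W j i = 0) /\
  (forall i, \sum_j c j * W j i ^+ 2 + c i * W i i = 0).
Proof.
move=> pP inv.
have q0 (x : 'cV[k]_m) :
    \sum_i c i * ((W *m x) i 0 ^+ 2) + \sum_i c i * ((W *m x) i 0 * x i 0) = 0.
  have [v vE] := adapted_surj x; have := inv v.
  rewrite (adapted_eval _ _ pP) vE => /(canRL (addKr _)); rewrite addNr => H; rewrite -[RHS]H.
  by rewrite -big_split; apply: eq_bigr => i _ /=; rewrite mulrDr.
have one_term j (F : 'I_m -> k) : \sum_i F i * (delta_mx j 0 : 'cV[k]_m) i 0 = F j.
  rewrite (bigD1 j) //= big1 => [|i ij]; first by rewrite mxE !eqxx mulr1 addr0.
  by rewrite mxE (negPf ij) mulr0.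
have diag j : \sum_i c i * W i j ^+ 2 + c j * W j j = 0.
  have := q0 (delta_mx j 0); rewrite -colE.
  under [X in _ + X]eq_bigr do rewrite mulrA.
  by rewrite one_term mxE => H; rewrite -[RHS]H; congr (_ + _); apply: eq_bigr => i _; rewrite mxE.
split=> // i j ij; have := q0 (delta_mx i 0 + delta_mx j 0).
rewrite mulmxDr -!colE.
under eq_bigr => l _.
  have -> : c l * (col i W + col j W) l 0 ^+ 2 = c l * W l i ^+ 2 + c l * W l j ^+ 2.
    by rewrite !mxE sqrrD mulr2n addrr_char2 // addr0 mulrDr.
  over.
rewrite big_split /=.
under [X in _ + X]eq_bigr => l _.
  have -> : c l * ((col i W + col j W) l 0 * (delta_mx i 0 + delta_mx j 0 : 'cV[k]_m) l 0)
   = (c l * (W l i + W l j)) * (delta_mx i 0 : 'cV[k]_m) l 0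
     + (c l * (W l i + W l j)) * (delta_mx j 0 : 'cV[k]_m) l 0.
    have addE (u v : 'cV[k]_m) : (u + v) l 0 = u l 0 + v l 0 by rewrite mxE.
    have colE' a : col a W l 0 = W l a by rewrite mxE.
    by rewrite !addE !colE' mulrA mulrDr.
  over.
rewrite big_split /= !one_term => H.
transitivity (\sum_l c l * W l i ^+ 2 + \sum_l c l * W l j ^+ 2
  + (c i * (W i i + W i j) + c j * (W j i + W j j))
  - (\sum_l c l * W l i ^+ 2 + c i * W i i) - (\sum_l c l * W l j ^+ 2 + c j * W j j)).
  by ring.
by rewrite H !diag !subr0.
Qed.

Lemma frame_isometry (A : 'M[k]_n) :
  A *m E = E -> b *m A = b ->
  (forall v, evalv f (A *m v) = evalv f v) -> (forall v, evalv g (A *m v) = evalv g v) ->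
  exists2 d : 'rV[k]_m, forall i, d 0 i = 0 \/ d 0 i = 1 & A = frame_mx d.
Proof.
move=> AE bA fA gA.
(* [b] kills A - 1 from the left, and the kernel of [b] is the span of [E]. The matrices are
   transposed to fit [mulmx0_factor]. *)
have [Z DZ] : exists Z, A - 1%:M = E *m Z.
  have [||||Z EZ] := @mulmx0_factor k n m E^T b^T n (A - 1%:M)^T nE.
  - by rewrite -trmx_mul bE0 trmx0.
  - by rewrite mxrank_tr.
  - by rewrite mxrank_tr.
  - by rewrite -trmx_mul mulmxBr bA mulmx1 subrr trmx0.
  by exists Z^T; apply: trmx_inj; rewrite EZ trmx_mul trmxK.
(* A - 1 also kills [E]; the left inverse [C^T] of [E] turns this into Z E = 0, so [Z] factors
   through [b]. *)
have [W ZW] : exists W, Z = W *m b.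
  apply: mulmx0_factor nE bE0 rankb rankE _.
  have /row_freeP[C EC] : row_free E^T by rewrite /row_free mxrank_tr rankE.
  have CE : C^T *m E = 1%:M by apply: trmx_inj; rewrite trmx_mul trmxK EC trmx1.
  by rewrite -[Z]mul1mx -CE -[_ *m Z]mulmxA -DZ -mulmxA mulmxBl AE mul1mx subrr mulmx0.
have AW : A = 1%:M + E *m W *m b by rewrite -mulmxA -ZW -DZ addrC subrK.
have inv (p : {mpoly k[n]}) : (forall v, evalv p (A *m v) = evalv p v) ->
    forall v, evalv p (v + E *m (W *m (b *m v))) = evalv p v.
  by move=> pA v; rewrite -[RHS]pA AW mulmxDl mul1mx -!mulmxA.
have [fW fD] := frame_invariance_relations fP (inv _ fA).
have [gW gD] := frame_invariance_relations gP (inv _ gA).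
(* The relations for [t] and [s] form a linear system in W_ij and W_ji whose determinant is s_i t_j
   - s_j t_i up to sign. *)
have W0 i j : i != j -> W i j = 0.
  move=> ij; have st := st_indep ij.
  have E1 : (s i * t j - s j * t i) * W i j = 0.
    transitivity (t j * (s i * W i j + s j * W j i) - s j * (t i * W i j + t j * W j i)).
      by ring.
    by rewrite fW // gW // !mulr0 subrr.
  by move/eqP: E1; rewrite mulf_eq0 subr_eq0 (negPf st) => /eqP.
have diag c i : \sum_j c j * W j i ^+ 2 + c i * W i i = c i * (W i i ^+ 2 + W i i).
  rewrite (bigD1 i) //= big1 ?addr0 ?mulrDr // => j ji.
  by rewrite W0 // expr0n mulr0.
(* Off-diagonal entries being 0, a diagonal entry w satisfies w^2 + w = 0, so it is 0 or -1 = 1. *)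
exists (\row_i W i i) => [i|].
  have : W i i ^+ 2 + W i i = 0 by apply: (@pencil_cancel i); rewrite -diag.
  rewrite mxE expr2 -[X in _ + X]mul1r -mulrDl => /eqP; rewrite mulf_eq0 orbC.
  case/orP=> /eqP; first by left.
  by move=> E1; right; apply/eqP; rewrite -subr_eq0 (oppr_pchar2 char2) E1.
rewrite AW /frame_mx; congr (_ + _ *m _ *m _); apply/matrixP => i j; rewrite !mxE.
by case: eqVneq => [->|/W0].
Qed.
End AdaptedFrame.

(** * Construction of the frame from the roots of the Pfaffian *)

Lemma pfaffian_eval (k : fieldType) n (f g : {mpoly k[n]}) P (y : 'cV[k]_2) :
  is_pfaffian f g P ->
  evalv P y ^+ 2 = \det (y 0 0 *: polar_mx f - y 1 0 *: polar_mx g).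
Proof.
move=> /(congr1 (fun p => evalv p y)); rewrite /evalv rmorphXn /= => ->.
rewrite -det_map_mx; congr (\det _); apply/matrixP => i j.
by rewrite !mxE rmorphB !rmorphM /= !mevalXU !mevalC.
Qed.

(** The sum of eigenspaces for distinct eigenvalues is direct, so each term of a vanishing
    combination of the rows vanishes. *)
Lemma eigenvector_rank (k : fieldType) n m (T : 'M[k]_n) (E : 'M[k]_(m, n)) (l : 'I_m -> k) :
  injective l -> (forall i, row i E != 0) -> (forall i, row i E *m T = l i *: row i E) ->
  row_free E.
Proof.
move=> linj E0 ET; apply: inj_row_free => v vE.
have /mxdirect_sumsP dir : mxdirect (\sum_i eigenspace T (l i))%MS.
  by apply: mxdirect_sum_eigenspace => i j _ _; apply: linj.
have sE i : (v 0 i *: row i E <= eigenspace T (l i))%MS.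
  by apply: scalemx_sub; apply/eigenspaceP.
apply/rowP => i; rewrite mxE.
have : v 0 i *: row i E = 0.
  apply/eqP; rewrite -submx0 -(dir i isT) sub_capmx sE.
  have -> : v 0 i *: row i E = - \sum_(j | j != i) v 0 j *: row j E.
    by apply/eqP; rewrite -addr_eq0; move: vE; rewrite mulmx_sum_row (bigD1 i) //= => ->.
  rewrite -scaleN1r scalemx_sub // summx_sub // => j ji.
  by apply: submx_trans (sE j) _; apply: (sumsmx_sup j) => //=.
by move/eqP; rewrite scaler_eq0 (negPf (E0 i)) orbF => /eqP.
Qed.

Lemma ord2P (i : 'I_2) : i = 0 \/ i = 1.
Proof. by case: i => [[|[|//]] h]; [left|right]; apply: val_inj. Qed.

Record pencil_frame (k : fieldType) n m (f g : {mpoly k[n]}) (E : 'M[k]_(n, m))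
    (b : 'M[k]_(m, n)) (t s : 'I_m -> k) : Prop := PencilFrame {
  frame_bE : b *m E = 0;
  frame_rankE : \rank E = m;
  frame_rankb : \rank b = m;
  frame_f : adapted E b f t;
  frame_g : adapted E b g s;
  frame_indep : forall i j, i != j -> s i * t j != s j * t i;
  frame_neq0 : forall i, (s i != 0) || (t i != 0);
  frame_sing : forall i, sing_vec f g (s i) (t i) (col i E) }.

Lemma pencil_frame_exists (k : closedFieldType) (char2 : (2%N \in [pchar k]))
  n m (f g : dhomog n.+1 k 2) :
  odd n -> smoothX f g -> pfaffian_distinct_roots m f g ->
  exists (E : 'M[k]_(n.+1, m)) b t s, pencil_frame f g E b t s.
Proof.
move=> oddn X_smooth [P [PfP [r [rinj rP]]]].
have hf : mpoly_of_dhomog f \is 2.-homog := dhomog_is_dhomog f.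
have hg : mpoly_of_dhomog g \is 2.-homog := dhomog_is_dhomog g.
pose s i := (repr (r i) : 'cV[k]_2) 0 0; pose t i := (repr (r i) : 'cV[k]_2) 1 0.
have st0 i : (s i != 0) || (t i != 0).
  rewrite -negb_and; apply: contra (nzv_neq0 (repr (r i))) => /andP[/eqP si /eqP ti].
  apply/eqP/colP => j; rewrite [RHS]mxE.
  by case: (ord2P j) => ->.
have indep i j : i != j -> s i * t j != s j * t i.
  apply: contraNneq => E; apply/eqP/rinj; rewrite -[r i]reprK -[r j]reprK.
  apply/Proj_eqP/proportionalP.
  have [mu [ti si]] : exists mu, t i = mu * t j /\ s i = mu * s j.
    by apply: proportional_pair (st0 j) _; rewrite -E mulrC.
  exists mu.
    by apply: contraTneq (st0 i) => mu0; rewrite ti si mu0 !mul0r eqxx.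
  by apply/colP => a; rewrite mxE; case: (ord2P a) => ->.
(* The point [1 : c] is to differ from every root [s_i : t_i]. If s_i = 0, the listed quotient is 0
   by convention, and t_i - c s_i = t_i is nonzero anyway. *)
have [c cP] := closed_field_avoid [seq t i / s i | i <- enum 'I_m].
have tcs i : t i - c * s i != 0.
  rewrite subr_eq0; apply: contra cP => /eqP tE; apply/mapP; exists i; first by rewrite mem_enum.
  have si : s i != 0 by apply: contraTneq (st0 i) => si; rewrite tE si mulr0 eqxx.
  by rewrite tE mulfK.
pose B := polar_mx f - c *: polar_mx g.
(* [B] is the polar matrix of the member at [1 : c]; were it singular, that point would be a
   root. *)
have Bunit : B \in unitmx.
  rewrite unitmxE unitfE; apply/eqP => B0.
  pose y : 'cV[k]_2 := \col_i (if i == 0 then 1 else c).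
  have y0 : y != 0.
    by apply/eqP => /colP/(_ 0)/eqP; rewrite !mxE oner_eq0.
  have [a a0 /= aE] := Proj_reprP (MkNzvec y0).
  have : evalv P (repr (\pi_(Proj k 1) (MkNzvec y0))) = 0.
    apply/eqP; rewrite -sqrf_eq0 (pfaffian_eval _ PfP) aE !mxE /= mulr1 -scalerA -scalerBr.
    by rewrite detZ -/B B0 mulr0.
  case/rP => i yr; have := tcs i; rewrite /t /s -yr aE !mxE /= mulr1 mulrC subrr eqxx //.
have det0 i : \det (s i *: polar_mx f - t i *: polar_mx g) = 0.
  rewrite -(pfaffian_eval _ PfP); have -> : evalv P (repr (r i)) = 0 by apply/rP; exists i.
  by rewrite expr0n.
have /fin_all_exists[e eP] i := sing_vec_exists char2 oddn X_smooth (st0 i) (det0 i).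
pose E := \matrix_(j, i) e i j 0.
have eE i : col i E = e i by apply/colP => j; rewrite !mxE.
(* The desired A_f(e_i, -) = t_i b_i and A_g(e_i, -) = s_i b_i force (t_i - c s_i) b_i to be the
   linear form given by B e_i. *)
pose b := \matrix_(i, j) ((t i - c * s i)^-1 * (B *m e i) j 0).
have pfg i v : s i * polar f (e i) v = t i * polar g (e i) v.
  by rewrite ![polar _ (e i) _]polarC; apply: sing_polar; have [_ []] := eP i.
have bv i v : (b *m v) i 0 = (t i - c * s i)^-1 * (polar f (e i) v - c * polar g (e i) v).
  rewrite ![polar _ (e i) _]polarC !polar_mulmx //.
  transitivity ((t i - c * s i)^-1 * (v^T *m (B *m e i)) 0 0).
    rewrite mxE [in RHS]mxE big_distrr; apply: eq_bigr => j _ /=.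
    by rewrite [b _ _]mxE [v^T _ _]mxE -mulrA [_ * v j 0]mulrC.
  congr (_ * _); rewrite /B mulmxBl mulmxBr -scalemxAl -scalemxAr.
  have subE (X Y : 'M[k]_1) : (X - c *: Y) 0 0 = X 0 0 - c * Y 0 0 by rewrite !mxE.
  by rewrite subE.
have fP : adapted E b f t.
  split=> // [i|i v]; rewrite eE; first by have [] := eP i.
  rewrite bv mulrCA; apply: (mulfI (tcs i)); rewrite mulVKf //.
  transitivity (t i * polar f (e i) v - c * (s i * polar f (e i) v)); first by ring.
  by rewrite pfg; ring.
have gP : adapted E b g s.
  split=> // [i|i v]; rewrite eE; first by have [] := eP i.
  rewrite bv mulrCA; apply: (mulfI (tcs i)); rewrite mulVKf //.
  transitivity (t i * polar g (e i) v - c * s i * polar g (e i) v); first by ring.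
  by rewrite -pfg; ring.
have canc i x : t i * x = 0 -> s i * x = 0 -> x = 0 by apply: pencil_cancel.
(* For i != j, symmetry of A_f and A_g gives t_i b_i(e_j) = t_j b_j(e_i) and s_i b_i(e_j) = s_j
   b_j(e_i), a system with nonzero determinant. For i = j both polar forms are alternating. *)
have bE : b *m E = 0.
  apply/matrixP => i j; have -> : (b *m E) i j = (b *m col j E) i 0.
    by rewrite colE mulmxA -colE [RHS]mxE.
  rewrite [RHS]mxE; have [_ _ fe] := fP; have [_ _ ge] := gP.
  have [->|ij] := eqVneq i j.
    by apply: (canc j); rewrite -?fe -?ge polarvv // mulr2n addrr_char2.
  have fx : t i * (b *m col j E) i 0 = t j * (b *m col i E) j 0 by rewrite -!fe polarC.
  have gx : s i * (b *m col j E) i 0 = s j * (b *m col i E) j 0 by rewrite -!ge polarC.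
  have /eqP : (s i * t j - s j * t i) * (b *m col j E) i 0 = 0.
    transitivity (t j * (s i * (b *m col j E) i 0) - s j * (t i * (b *m col j E) i 0)).
      by ring.
    by rewrite fx gx; ring.
  by rewrite mulf_eq0 subr_eq0 (negPf (indep _ _ ij)) => /eqP.
(* The equation s_i A_f e_i = t_i A_g e_i makes the transpose of e_i a left eigenvector of A_g B^-1
   with eigenvalue s_i / (t_i - c s_i); these are distinct because the roots are. *)
have freeE : row_free E^T.
  apply: (@eigenvector_rank _ _ _ (polar_mx g *m invmx B) E^T
            (fun i => s i / (t i - c * s i))) => [i j|i|i].
  - move=> /eqP; rewrite eqr_div // => /eqP H; apply/eqP; apply: contraT => /indep/eqP[].
    by transitivity (s i * (t j - c * s j) + c * s i * s j); [ring | rewrite H; ring].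
  - rewrite -tr_col eE -trmx0 (inj_eq trmx_inj).
    by have [] := eP i.
  rewrite -tr_col eE; have [_ [sf _] _ _] := eP i.
  have eB : s i *: ((e i)^T *m B) = (t i - c * s i) *: ((e i)^T *m polar_mx g).
    apply: trmx_inj; rewrite !linearZ /= !trmx_mul !trmxK polar_mx_sym.
    rewrite /B linearB linearZ /= !polar_mx_sym // mulmxBl scalerBr sf -scalemxAl.
    by rewrite scalerBl !scalerA [s i * c]mulrC.
  apply: (scalerI (tcs i)); rewrite mulmxA scalemxAl -eB -scalemxAl mulmxK //.
  by rewrite scalerA mulrC divfK.
have rankE : \rank E = m by rewrite -mxrank_tr; apply/eqP.
exists E, b, t, s; split=> // [|i]; last by rewrite eE; have [] := eP i.
(* Both factors around [E^T] are invertible, so [b] has the rank of [E]. *)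
have -> : b = diag_mx (\row_i (t i - c * s i)^-1) *m (E^T *m B).
  apply/matrixP => i j; rewrite mul_diag_mx !mxE; congr (_ * _).
  apply: eq_bigr => l _; rewrite !mxE mulrC; congr (_ * _).
  by rewrite ![polar _ (delta_mx j 0) _]polarC.
rewrite (eqmxMfull _ _) ?row_full_unit ?unitmxE ?det_diag ?unitfE.
  by rewrite mxrankMfree ?row_free_unit // mxrank_tr.
by apply/prodf_neq0 => i _; rewrite mxE invr_eq0.
Qed.

(** * The action on the pencil *)

(** All monomials of [p] have degree d, so only the constant term of [a] contributes in degree d. *)
Lemma mcoeffM_dhomog (k : fieldType) n d (a p : {mpoly k[n]}) (m : 'X_{1..n}) :
  p \is d.-homog -> mdeg m = d -> (a * p)@_m = a@_0%MM * p@_m.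
Proof.
move=> /dhomogP hp md.
rewrite -[a in LHS](subrK (a@_0%MM)%:MP) mulrDl mcoeffD mul_mpolyC mcoeffZ.
rewrite [X in X + _]mcoeffM big1 ?add0r // => -[m1 m2] /=.
move: (m1 : 'X_{1..n}) (m2 : 'X_{1..n}) => {}m1 {}m2 /eqP mE.
have [->|m10] := eqVneq m1 0%MM.
  by rewrite mcoeffB mcoeffC eqxx mulr1 subrr mul0r.
have [/hp /= m2d|m2p] := boolP (m2 \in msupp p); last by rewrite (memN_msupp_eq0 m2p) mulr0.
have := congr1 mdeg mE; rewrite mdegD.
by rewrite md m2d -[LHS]add0n => /addIn/esym/eqP; rewrite mdeg_eq0 (negPf m10).
Qed.

(** In degree 2 only the constant terms of the cofactors survive, so the ideal meets the quadratic
    forms in the span of f and g. *)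
Lemma in_idealX_dhomog2 (k : fieldType) n (f g : dhomog n.+1 k 2) p :
  p \is 2.-homog -> in_idealX f g p ->
  exists c d : k, forall v, evalv p v = c * evalv f v + d * evalv g v.
Proof.
move=> hp [a [b pE]]; exists a@_0%MM, b@_0%MM => v.
suff -> : p = a@_0%MM *: mpoly_of_dhomog f + b@_0%MM *: mpoly_of_dhomog g.
  by rewrite /evalv mevalD !mevalZ.
apply/mpolyP => m; rewrite mcoeffD !mcoeffZ.
have [md|md] := eqVneq (mdeg m) 2.
  by rewrite pE mcoeffD !(mcoeffM_dhomog _ (dhomog_is_dhomog _)).
by rewrite !(dhomog_nemf_coeff _ md) ?mulr0 ?addr0 //; exact: dhomog_is_dhomog.
Qed.

Lemma mulmx_col2 (k : fieldType) p (C : 'M[k]_(p, 2)) (v : 'cV[k]_2) a :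
  (C *m v) a 0 = C a 0 * v 0 0 + C a 1 * v 1 0.
Proof.
rewrite mxE !big_ord_recl big_ord0 addr0; congr (_ + C a _ * v _ 0); exact: val_inj.
Qed.

Definition intertwines (k : fieldType) n (f g : dhomog n.+1 k 2) (A : 'M[k]_n.+1) (C : 'M[k]_2) :=
  forall v, fg_vec f g (A *m v) = C *m fg_vec f g v.

Section Pencil.
Variables (k : closedFieldType) (char2 : 2%N \in [pchar k]).
Variables (n m : nat) (f g : dhomog n.+1 k 2).
Variables (E : 'M[k]_(n.+1, m)) (b : 'M[k]_(m, n.+1)) (t s : 'I_m -> k).
Hypotheses (F : pencil_frame f g E b t s) (nE : n.+1 = (m + m)%N) (m_gt1 : (1 < m)%N).
Hypothesis X_smooth : smoothX f g.
Let hf : mpoly_of_dhomog f \is 2.-homog := dhomog_is_dhomog f.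
Let hg : mpoly_of_dhomog g \is 2.-homog := dhomog_is_dhomog g.

Lemma fg_vecZ c v : fg_vec f g (c *: v) = c ^+ 2 *: fg_vec f g v.
Proof.
apply/colP => i; rewrite !mxE (evalvZ_homog _ _ hf) (evalvZ_homog _ _ hg).
by case: ifP.
Qed.

(** The vector (f, g) takes the value (t_l, s_l) at e_l, and two of these values, available as m >
    1, span k^2. *)
Lemma fg_vec_span (C D : 'M[k]_2) :
  (forall v, C *m fg_vec f g v = D *m fg_vec f g v) -> C = D.
Proof.
move=> H; pose i : 'I_m := Ordinal (ltnW m_gt1); pose j : 'I_m := Ordinal m_gt1.
have ij : i != j by [].
have E1 l a : (C a 0 - D a 0) * t l + (C a 1 - D a 1) * s l = 0.
  have [_ fl _] := frame_f F; have [_ gl _] := frame_g F.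
  have /colP/(_ a) := H (col l E).
  rewrite !mulmx_col2 !mxE /= fl gl => /eqP; rewrite -subr_eq0 => /eqP <-; ring.
have st : s i * t j - s j * t i != 0 by rewrite subr_eq0 (frame_indep F).
have E0 a : C a 0 - D a 0 = 0.
  apply: (mulIf st); rewrite mul0r.
  transitivity (s i * ((C a 0 - D a 0) * t j + (C a 1 - D a 1) * s j)
     - s j * ((C a 0 - D a 0) * t i + (C a 1 - D a 1) * s i)); first by ring.
  by rewrite !E1 !mulr0 subrr.
have E1' a : C a 1 - D a 1 = 0.
  apply: (mulIf st); rewrite mul0r.
  transitivity (t j * ((C a 0 - D a 0) * t i + (C a 1 - D a 1) * s i)
     - t i * ((C a 0 - D a 0) * t j + (C a 1 - D a 1) * s j)); first by ring.
  by rewrite !E1 !mulr0 subrr.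
apply/matrixP => a c; apply/eqP; rewrite -subr_eq0.
by case: (ord2P c) => ->; rewrite ?E0 ?E1'.
Qed.

Lemma stabX_intertwines (A : GL k n.+1) :
  \pi_(PGL k n.+1) A \in stabX f g -> exists C, intertwines f g A C.
Proof.
move=> /stabXP AX.
have [a [c fE]] := in_idealX_dhomog2 (dhomog2_pullback hf A) ((AX _).2 (in_idealX_f f g)).
have [a' [c' gE]] := in_idealX_dhomog2 (dhomog2_pullback hg A) ((AX _).2 (in_idealX_g f g)).
exists (\matrix_(i, j) if i == 0 then (if j == 0 then a else c) else (if j == 0 then a' else c')).
move=> v; apply/colP => i; rewrite mulmx_col2 !mxE /=.
by rewrite -!evalv_pullback fE gE; case: (i == 0).
Qed.

(** The matrices [C] and [C'] induced by a representative and by its inverse satisfy C C' = 1 on all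
    values of (f, g), and these values span. *)
Lemma stabX_intertwinesGL (x : AutX f g) :
  exists C : GL k 2, intertwines f g (repr (autX x) : GL k n.+1) C.
Proof.
have [|C CP] := @stabX_intertwines (repr (autX x)); first by rewrite reprK autX_stab.
have [|C' C'P] := @stabX_intertwines (repr (autX x))^-1%g.
  by rewrite PGL_piV reprK; exact: (autX_stab x^-1%g).
suff CC : C *m C' = 1%:M by exists (MkGL (mulmx1_unit CC).1).
by apply: fg_vec_span => v; rewrite mul1mx -mulmxA -C'P -CP mulKVmx // GLmx_unit.
Qed.

Definition phi_starGL (x : AutX f g) : GL k 2 :=
  sval (cid (stabX_intertwinesGL x)).
Definition phi_starP (x : AutX f g) : PGL k 2 := \pi_(PGL k 2) (phi_starGL x).

Lemma phi_starGLP (x : AutX f g) : intertwines f g (repr (autX x) : GL k n.+1) (phi_starGL x).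
Proof. exact: (svalP (cid (stabX_intertwinesGL x))). Qed.

(** Rescaling the representative by c multiplies the induced matrix by c^2, which disappears in
    PGL_2. Hence [phi_starP] can be computed from any representative. *)
Lemma phi_starP_uniq (x : AutX f g) (A : GL k n.+1) (C : GL k 2) :
  autX x = \pi_(PGL k n.+1) A -> intertwines f g A C -> phi_starP x = \pi_(PGL k 2) C.
Proof.
move=> xA CP; apply/PGL_eqP/GL_scalP.
have [c c0 cA] := PGL_reprP A.
exists (c ^+ 2); first by rewrite expf_neq0.
apply: fg_vec_span => v; rewrite -(phi_starGLP x) xA cA -scalemxAl fg_vecZ CP.
by rewrite scalemxAl.
Qed.

Lemma phi_starP_mul : {morph phi_starP : x y / (x * y)%g}.
Proof.
move=> x y; have -> : (phi_starP x * phi_starP y)%g = \pi_(PGL k 2) (phi_starGL x * phi_starGL y)%g.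
  by rewrite PGL_piM.
apply: (@phi_starP_uniq (x * y)%g (repr (autX x) * repr (autX y))%g
  (phi_starGL x * phi_starGL y)%g).
  by rewrite PGL_piM !reprK.
by move=> v; rewrite /= -!mulmxA !phi_starGLP.
Qed.

Lemma phi_starP1 : phi_starP 1%g = 1%g.
Proof.
rewrite -PGL_pi1; apply: (@phi_starP_uniq 1%g 1%g 1%g) => //.
by move=> v /=; rewrite !mul1mx.
Qed.

(** * Equivariance of phi and stability of phi(Z) *)

Lemma phi_equivariant (x : AutX f g) (p : complX f g) :
  phi (AutXact x p) = Pact (phi_starP x) (phi p).
Proof.
rewrite /phi /phi_starP Pact_pi; apply/Proj_eqP/proportionalP => /=.
have [c c0 /= cE] := Proj_reprP (GLact (repr (autX x)) (repr (cX p))).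
exists (c ^+ 2); first by rewrite expf_neq0.
by rewrite /Pact cE fg_vecZ phi_starGLP.
Qed.

(** A coordinate-free form of the vanishing of g df - f dg, suited to linear changes of
    variables. *)
Lemma dphi_eq0P v : reflect
  (forall w, evalv g v * polar f w v = evalv f v * polar g w v) (dphi f g v == 0).
Proof.
apply: (iffP eqP) => [d0 w|H].
  rewrite !polar_mulmx //.
  have : evalv g v *: (polar_mx f *m v) = evalv f v *: (polar_mx g *m v).
    apply/colP => j; have /rowP/(_ j) := d0.
    rewrite !mxE !mderiv_polar // !mxE => /eqP; rewrite subr_eq0 => /eqP //.
  move=> /(congr1 (fun u => (w^T *m u) 0 0)); rewrite -!scalemxAr.
  by rewrite ![(_ *: (_ : 'M[k]_(_, _))) _ _]mxE.
apply/rowP => j; rewrite !mxE !mderiv_polar //; apply/eqP; rewrite subr_eq0; apply/eqP.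
by have := H (delta_mx j 0); rewrite !polar_mulmx // trmx_delta -!rowE ![row _ _ _ _]mxE.
Qed.

(** The change of variables [A] multiplies g df - f dg by det C, so zeros go to zeros. *)
Lemma dphi_intertwines (A : GL k n.+1) C v :
  intertwines f g A C -> dphi f g v = 0 -> dphi f g ((A : 'M[k]_n.+1) *m v) = 0.
Proof.
move=> AC /eqP/dphi_eq0P d0; apply/eqP/dphi_eq0P => w.
have fA u : evalv f ((A : 'M[k]_n.+1) *m u) = C 0 0 * evalv f u + C 0 1 * evalv g u.
  by have /colP/(_ 0) := AC u; rewrite mulmx_col2 !mxE.
have gA u : evalv g ((A : 'M[k]_n.+1) *m u) = C 1 0 * evalv f u + C 1 1 * evalv g u.
  by have /colP/(_ 1) := AC u; rewrite mulmx_col2 !mxE.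
rewrite -[w](mulKVmx (GLmx_unit A)); set u := invmx A *m w.
rewrite /polar -!mulmxDr !fA !gA.
have H := d0 u; rewrite /polar in H.
apply/eqP; rewrite -subr_eq0; apply/eqP.
set fv := evalv f v in H *; set gv := evalv g v in H *.
set fu := evalv f u in H *; set gu := evalv g u in H *.
set fuv := evalv f _ in H *; set guv := evalv g _ in H *.
transitivity ((C 1 1 * C 0 0 - C 1 0 * C 0 1) *
   (gv * (fuv - fu - fv) - fv * (guv - gu - gv))); first by ring.
by rewrite H subrr mulr0.
Qed.

Lemma dphiZ c v : dphi f g v = 0 -> dphi f g (c *: v) = 0.
Proof.
move=> /eqP/dphi_eq0P d0; apply/eqP/dphi_eq0P => w.
by rewrite (evalvZ_homog _ _ hf) (evalvZ_homog _ _ hg) !polarZr // mulrACA d0 mulrACA.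
Qed.

Lemma singZ_act (x : AutX f g) (p : complX f g) : p \in @singZ k n f g -> AutXact x p \in @singZ k n f g.
Proof.
move=> /eqP pZ; apply/eqP; rewrite /= /Pact.
have [c c0 /= ->] := Proj_reprP (GLact (repr (autX x)) (repr (cX p))).
exact/dphiZ/(dphi_intertwines (@phi_starGLP x)).
Qed.

Lemma phiZ_act (x : AutX f g) y : y \in phiZ f g -> Pact (phi_starP x) y \in phiZ f g.
Proof.
move=> /asboolP[p pZ <-]; apply/asboolP; exists (AutXact x p); first exact: singZ_act.
exact: phi_equivariant.
Qed.

Lemma phi_starP_stab (x : AutX f g) : phi_starP x \in stabPGL (phiZ f g).
Proof.
apply/asboolP => y; apply/idP/idP; last exact: phiZ_act.
move=> /(phiZ_act x^-1%g); rewrite -PactM -phi_starP_mul.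
by rewrite mulVg phi_starP1 Pact1.
Qed.

Definition phi_star (x : AutX f g) : AutProj (phiZ f g) := MkAutProj (phi_starP_stab x).

Lemma phi_star_mul : {morph phi_star : x y / (x * y)%g}.
Proof. by move=> x y; apply: val_inj; rewrite /= phi_starP_mul. Qed.

(** * The kernel of the action on the pencil *)

(** [A] preserves both polar forms, so A e_i is a singular vector over the same point and equals c
    e_i; comparing values gives c^2 = 1, so c = 1 in characteristic 2. Then t_i b_i = A_f(e_i, -)
    and s_i b_i = A_g(e_i, -) are invariant, hence so is b_i. *)
Lemma isometry_fixes_frame (A : 'M[k]_n.+1) :
  A \in unitmx -> (forall v, evalv f (A *m v) = evalv f v) ->
  (forall v, evalv g (A *m v) = evalv g v) -> A *m E = E /\ b *m A = b.
Proof.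
move=> Aunit fA gA.
have polA (p : {mpoly k[n.+1]}) : (forall v, evalv p (A *m v) = evalv p v) ->
    forall u v, polar p (A *m u) (A *m v) = polar p u v.
  by move=> pA u v; rewrite /polar -mulmxDr !pA.
have mxA (p : {mpoly k[n.+1]}) : p \is 2.-homog -> (forall v, evalv p (A *m v) = evalv p v) ->
    forall v : 'cV[k]_n.+1, A^T *m (polar_mx p *m (A *m v)) = polar_mx p *m v.
  move=> hp pA v; apply/colP => i.
  have rowi (u : 'cV[k]_n.+1) : u i 0 = ((delta_mx i 0 : 'cV[k]_n.+1)^T *m u) 0 0.
    by rewrite trmx_delta -rowE [RHS]mxE.
  by rewrite rowi [RHS]rowi mulmxA -trmx_mul -!polar_mulmx // polA.
have AE i : A *m col i E = col i E.
  have [sf sq] := frame_sing F i; have [_ fi _] := frame_f F; have [_ gi _] := frame_g F.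
  have st0 := frame_neq0 F i.
  have e0 : col i E != 0.
    apply: contraTneq st0 => e0; have := fi i; have := gi i.
    rewrite e0 -[0 : 'cV_ _](scale0r (0 : 'cV[k]_n.+1)).
    by rewrite (evalvZ_homog _ _ hf) (evalvZ_homog _ _ hg) expr0n !mul0r => <- <-; rewrite eqxx.
  have sA : sing_vec f g (s i) (t i) (A *m col i E).
    split; last by rewrite fA gA.
    have AT : A^T \in unitmx by rewrite unitmx_tr.
    apply: (can_inj (mulKmx AT)).
    by rewrite -!scalemxAr !mxA.
  have [c cE] := sing_vec_unique X_smooth st0 e0 sA (frame_sing F i).
  have c1 : c ^+ 2 = 1.
    apply/eqP; rewrite -subr_eq0; apply/eqP; apply: (pencil_cancel (frame_neq0 F) (i := i)).
      by rewrite mulrBr mulr1 -{1}fi mulrC -(evalvZ_homog _ _ hf) -cE fA fi subrr.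
    by rewrite mulrBr mulr1 -{1}gi mulrC -(evalvZ_homog _ _ hg) -cE gA gi subrr.
  have : (c - 1) ^+ 2 = 0 by rewrite sqrrB c1 mulr1 expr1n mulr2n addrr_char2 // subr0 addrr_char2.
  by move=> /eqP; rewrite sqrf_eq0 subr_eq0 => /eqP c1'; rewrite cE c1' scale1r.
split.
  apply/matrixP => j i; transitivity (col i (A *m E) j 0); first by rewrite [RHS]mxE.
  by rewrite colE -mulmxA -colE AE mxE.
apply/matrixP => i j; have [_ _ fi] := frame_f F; have [_ _ gi] := frame_g F.
pose v : 'cV[k]_n.+1 := delta_mx j 0.
have entry (B : 'M[k]_(m, n.+1)) : B i j = (B *m v) i 0 by rewrite -colE mxE.
rewrite !entry -mulmxA; apply/eqP; rewrite -subr_eq0; apply/eqP.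
apply: (pencil_cancel (frame_neq0 F) (i := i)); rewrite mulrBr.
  by rewrite -!fi -{1}AE polA // subrr.
by rewrite -!gi -{1}AE polA // subrr.
Qed.

(** * The elementary abelian group of transvections *)

Definition bitsk (a : 'rV['Z_2]_m) : 'rV[k]_m := map_mx (fun z : 'Z_2 => (z : nat)%:R) a.

Lemma bitsk01 a i : bitsk a 0 i = 0 \/ bitsk a 0 i = 1.
Proof. by rewrite mxE; case: (a 0 i) => [[|[|//]] ?]; [left|right]. Qed.

Lemma bitskD a a' : bitsk (a + a') = bitsk a + bitsk a'.
Proof.
apply/rowP => i; rewrite !mxE -natrD.
case: (a 0 i) (a' 0 i) => [[|[|//]] ?] [[|[|//]] ?] //=.
exact/esym/(pcharf0 char2).
Qed.

Lemma bitsk_inj : injective bitsk.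
Proof.
move=> a a' /rowP H; apply/rowP => i; have := H i; rewrite !mxE.
case: (a 0 i) (a' 0 i) => [[|[|//]] ?] [[|[|//]] ?] // /eqP.
- by move=> _; apply: val_inj.
- by rewrite eq_sym oner_eq0.
- by rewrite oner_eq0.
by move=> _; apply: val_inj.
Qed.

Lemma bitsk_surj (d : 'rV[k]_m) : (forall i, d 0 i = 0 \/ d 0 i = 1) -> exists a, bitsk a = d.
Proof.
move=> d01; exists (\row_i if d 0 i == 0 then 0 else 1); apply/rowP => i; rewrite !mxE.
by case: (d01 i) => ->; rewrite ?eqxx ?oner_eq0.
Qed.

Definition frame_bits a := frame_mx E b (bitsk a).

Lemma frame_bits_mul a a' : frame_bits a *m frame_bits a' = frame_bits (a + a').
Proof. by rewrite /frame_bits frame_mx_mul ?(frame_bE F) // bitskD. Qed.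

Lemma frame_bits_sq a : frame_bits a *m frame_bits a = 1%:M.
Proof.
rewrite /frame_bits frame_mx_mul ?(frame_bE F) //.
have -> : bitsk a + bitsk a = 0 by apply/rowP => i; rewrite !mxE addrr_char2.
by rewrite /frame_mx linear0 mulmx0 mul0mx addr0.
Qed.

Lemma frame_bits_unit a : frame_bits a \in unitmx.
Proof. exact: (mulmx1_unit (frame_bits_sq a)).1. Qed.

Definition frame_bitsGL a : GL k n.+1 := MkGL (frame_bits_unit a).

Lemma frame_bits_intertwines a : intertwines f g (frame_bitsGL a) 1%:M.
Proof.
move=> v; rewrite mul1mx; apply/colP => i; rewrite !mxE /=.
by rewrite !(adapted_frame_mx char2 (frame_bE F) _ (frame_f F),
             adapted_frame_mx char2 (frame_bE F) _ (frame_g F)) //; apply: bitsk01.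
Qed.

(** Equality of values gives equality of quadratic forms, so f and g are both fixed; the converse
    inclusion holds because the matrix is its own inverse. *)
Lemma frame_bits_stab a : \pi_(PGL k n.+1) (frame_bitsGL a) \in stabX f g.
Proof.
have pbf : pullback (frame_bits a) f = f.
  apply: (eq_dhomog2 (dhomog2_pullback hf (frame_bits a)) hf) => v; rewrite evalv_pullback.
  exact: (adapted_frame_mx char2 (frame_bE F) _ (frame_f F) (bitsk01 a)).
have pbg : pullback (frame_bits a) g = g.
  apply: (eq_dhomog2 (dhomog2_pullback hg (frame_bits a)) hg) => v; rewrite evalv_pullback.
  exact: (adapted_frame_mx char2 (frame_bE F) _ (frame_g F) (bitsk01 a)).
have fwd p : in_idealX f g p -> in_idealX f g (pullback (frame_bits a) p).
  move=> [c [d ->]]; exists (pullback (frame_bits a) c), (pullback (frame_bits a) d).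
  by rewrite pullbackD !pullbackM pbf pbg.
apply/stabXP => p; split; last exact: fwd.
by move/fwd; rewrite -pullback_mul frame_bits_sq pullback1.
Qed.

Definition iotaX (a : 'rV['Z_2]_m) : AutX f g := MkAutX (frame_bits_stab a).

Lemma iotaX_mul : {morph iotaX : a a' / (a * a')%g}.
Proof.
move=> a a'; apply: val_inj; rewrite /= -PGL_piM; congr (\pi_(PGL k n.+1) _).
by apply: val_inj; rewrite /= frame_bits_mul.
Qed.

(** Equality in PGL is equality up to a scalar c. Both matrices fix the nonzero [E], so c = 1, and
    then [E] and [b], of full rank, cancel. *)
Lemma iotaX_inj : injective iotaX.
Proof.
move=> a a' /(congr1 (@autX _ _ _ _)) /= /PGL_eqP/GL_scalP [c _ /= cE].
have freeET : row_free E^T by rewrite /row_free mxrank_tr (frame_rankE F).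
have freeb : row_free b by rewrite /row_free (frame_rankb F).
have fixE a1 : frame_bits a1 *m E = E.
  by rewrite /frame_bits /frame_mx mulmxDl mul1mx -!mulmxA (frame_bE F) !mulmx0 addr0.
have c1 : c = 1.
  have := congr1 (mulmx^~ E) cE; rewrite /= -scalemxAl !fixE => EE.
  have E0 : E != 0.
    by apply: contraTneq m_gt1 => E0; rewrite -(frame_rankE F) E0 mxrank0.
  apply/eqP; rewrite -subr_eq0; have : (c - 1) *: E == 0.
    by rewrite scalerBl scale1r -EE subrr.
  by rewrite scaler_eq0 (negPf E0) orbF.
move: cE; rewrite c1 scale1r /frame_bits /frame_mx => /addrI/(row_free_inj freeb) EE.
apply: bitsk_inj; suff D : diag_mx (bitsk a) = diag_mx (bitsk a').
  by apply/rowP => i; have /matrixP/(_ i i) := D; rewrite !mxE eqxx !mulr1n.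
apply: trmx_inj; apply: (row_free_inj freeET).
by rewrite -!trmx_mul EE.
Qed.

Lemma phi_star_ker (x : AutX f g) : phi_star x = 1%g <-> exists a, iotaX a = x.
Proof.
split=> [x1|[a <-]]; last first.
  apply: val_inj; rewrite /= -PGL_pi1.
  by apply: (@phi_starP_uniq (iotaX a) (frame_bitsGL a) 1%g) => //; apply: frame_bits_intertwines.
have {x1} : phi_starP x = 1%g by rewrite -[phi_starP x]/(autP (phi_star x)) x1.
rewrite -PGL_pi1 => /PGL_eqP/GL_scalP[c c0 /= cE].
pose A : 'M[k]_n.+1 := repr (autX x) : GL k n.+1.
have fgA v : fg_vec f g (A *m v) = c *: fg_vec f g v.
  by rewrite phi_starGLP cE -scalemxAl mul1mx.
(* [A] multiplies f and g by c, and quadratic forms scale by d^2, so c d^2 = 1 makes [d *: A] an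
   isometry of both with the same class in PGL. *)
have [d dE] := closed_field_quadratic 0 (-1) c0.
have {}dE : c * d ^+ 2 = 1 by apply/eqP; rewrite -subr_eq0 -dE; apply/eqP; ring.
have d0 : d != 0 by apply: contra_eqN dE => /eqP ->; rewrite expr0n mulr0 eq_sym oner_eq0.
have Aunit : d *: A \in unitmx by rewrite unitmxZ ?unitfE // GLmx_unit.
have fgdA v : fg_vec f g ((d *: A) *m v) = fg_vec f g v.
  by rewrite -scalemxAl fg_vecZ fgA scalerA mulrC dE scale1r.
have fA v : evalv f ((d *: A) *m v) = evalv f v by have /colP/(_ 0) := fgdA v; rewrite !mxE.
have gA v : evalv g ((d *: A) *m v) = evalv g v by have /colP/(_ 1) := fgdA v; rewrite !mxE.
have [AE bA] := isometry_fixes_frame Aunit fA gA.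
have [w w01 Aw] := frame_isometry char2 (frame_bE F) nE (frame_rankE F) (frame_rankb F)
  (frame_f F) (frame_g F) (frame_indep F) (frame_neq0 F) AE bA fA gA.
have [a aw] := bitsk_surj w01; exists a; apply: val_inj; rewrite /= -[RHS]reprK.
by apply/PGL_eqP/GL_scalP; exists d => //=; rewrite /frame_bits aw -Aw.
Qed.
End Pencil.

Theorem theorem4p1 (k : closedFieldType) (char2 : (2%N \in [pchar k]))
  (M : nat) (f g : dhomog (2 * M).+2 k 2)
  (X_smooth : smoothX f g)
  (pf_distinct : pfaffian_distinct_roots M.+1 f g)
  (M_ge2 : (2 <= M)%N) :
  exists (iota : {multiplicative 'rV['Z_2]_M.+1 -> AutX f g})
         (phi_star : {multiplicative AutX f g -> AutProj (phiZ f g)}),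
    [/\ forall (s : AutX f g) (x : complX f g),
          phi (AutXact s x) = Pact (phi_star s) (phi x),
        injective iota
      & forall s : AutX f g, phi_star s = 1%g <-> exists a, iota a = s].
Proof.
(* Here n = 2M + 1, so there are n + 1 = 2m variables with m = M + 1. *)
have odd_n : odd (2 * M).+1 by rewrite /= mul2n odd_double.
have [E [b [t [s F]]]] := pencil_frame_exists char2 odd_n X_smooth pf_distinct.
have nE : (2 * M).+2 = (M.+1 + M.+1)%N by rewrite addnS addSn addnn -mul2n.
have M_gt1 : (1 < M.+1)%N by apply: leqW.
pose iotaM := isMultiplicative.Build _ _ (iotaX char2 F) (iotaX_mul char2 F).
pose iotaH : {multiplicative 'rV['Z_2]_M.+1 -> AutX f g} := HB.pack (iotaX char2 F) iotaM.
pose phiM := isMultiplicative.Build _ _ (phi_star F M_gt1) (phi_star_mul F M_gt1).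
pose phiH : {multiplicative AutX f g -> AutProj (phiZ f g)} := HB.pack (phi_star F M_gt1) phiM.
exists iotaH, phiH; split.
- exact: phi_equivariant.
- exact: iotaX_inj.
exact: phi_star_ker.
Qed.
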